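(* Let $w_0$ be the longest element of the Weyl group $W(D_5)$. There does not exist any $L_2$-accessible reduced word for $w_0$; that is, for every reduced word $r$ of $w_0$ there is a reduced word $r'$ of $w_0$ with $d(r,r')\neq |L_2(r,r')|$.
   Context: Type $D_n$ (here $n=5$): the positive roots are $\Phi^+=\{e_j-e_i: 1\le i<j\le n\}\cup\{e_j+e_i:1\le i<j\le n\}\subset\mathbb{R}^n$. The simple roots are $\alpha_1=e_1+e_2$ and $\alpha_i=e_i-e_{i-1}$ for $2\le i\le n$. $s_i$ is the reflection in the hyperplane orthogonal to $\alpha_i$, and $W(D_n)$ is the group generated by $s_1,\dots,s_n$, with $m_{ij}$ the order of $s_is_j$. $w_0$ is the unique element of maximum Coxeter length, and $\mathrm{Red}(w_0)$ is its set of reduced words. Distance: $G(w_0)$ is the graph with vertex set $\mathrm{Red}(w_0)$ in which two reduced words are joined by an edge when they differ by a single application of a Coxeter relation $s_is_j\cdots=s_js_i\cdots$ ($m_{ij}$ letters on each side, $i\neq j$). $d(r,r')$ is the graph distance in $G(w_0)$. Separation sets: let $\mathcal{A}$ be the arrangement of hyperplanes $H_\alpha=\{x:\langle x,\alpha\rangle=0\}$, $\alpha\in\Phi^+$, with fundamental chamber $C=\{x:\langle x,\alpha\rangle>0\ \forall\alpha\in\Phi^+\}$. A reduced word $r=s_{i_1}\cdots s_{i_\ell}$ is identified with the gallery (shortest path of adjacent chambers) $C,\ s_{i_1}C,\ s_{i_1}s_{i_2}C,\dots,\ w_0C$. Let $L_2$ be the set of codimension-two subspaces that are intersections of hyperplanes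 of $\mathcal{A}$. For $X\in L_2$, the gallery $r$ descends to a gallery $r/X$ in the localized arrangement $\mathcal{A}_X=\{H/X:H\in\mathcal{A},H\supset X\}$ (equivalently, one records the order in which $r$ crosses the hyperplanes containing $X$). Then $L_2(r,r')=\{X\in L_2: r/X\neq r'/X\}$. A reduced word $r\in\mathrm{Red}(w_0)$ is called $L_2$-accessible if $d(r,r')=|L_2(r,r')|$ for all $r'\in\mathrm{Red}(w_0)$. *)

(* Defs.v *)
From HB Require Import structures.
From mathcomp Require Import all_boot all_order all_algebra.
From mathcomp Require Import boolp classical_sets reals.
Set Implicit Arguments.
Unset Strict Implicit.
Unset Printing Implicit Defensive.

Import Order.TTheory GRing.Theory Num.Theory.
Local Open Scope ring_scope.

(* Indices are shifted by one: [basis_vec k] is e_{k+1}, and the letter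
   [i : 'I_n] of a word stands for the simple reflection s_{i+1}.  Vectors are
   columns and W(D_n) acts by left multiplication of matrices. *)

Definition dot (R : realType) (n : nat) (x y : 'cV[R]_n) : R :=
  (x^T *m y) 0 0.

Definition basis_vec (R : realType) (n : nat) (k : nat) : 'cV[R]_n :=
  \col_(i < n) ((i : nat) == k)%:R.

Definition pos_roots (R : realType) (n : nat) : seq 'cV[R]_n :=
  [seq basis_vec R n p.2 - basis_vec R n p.1
     | p <- [seq (i, j) | i <- iota 0 n, j <- iota 0 n] & (p.1 < p.2)%N] ++
  [seq basis_vec R n p.2 + basis_vec R n p.1
     | p <- [seq (i, j) | i <- iota 0 n, j <- iota 0 n] & (p.1 < p.2)%N].

Definition simple_root (R : realType) (n : nat) (i : 'I_n) : 'cV[R]_n :=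
  if (i : nat) == 0%N then basis_vec R n 0 + basis_vec R n 1
  else basis_vec R n i - basis_vec R n i.-1.

Definition reflection (R : realType) (n : nat) (a : 'cV[R]_n) : 'M[R]_n :=
  1%:M - (2 / dot a a) *: (a *m a^T).

Lemma reflectionE (R : realType) (n : nat) (a x : 'cV[R]_n) :
  reflection a *m x = x - (2 * dot a x / dot a a) *: a.
Proof.
rewrite /reflection mulmxBl mul1mx -scalemxAl -mulmxA.
rewrite [a^T *m x]mx11_scalar mul_mx_scalar scalerA.
by rewrite -/(dot a x) mulrAC.
Qed.

Definition simple_refl (R : realType) (n : nat) (i : 'I_n) : 'M[R]_n :=
  reflection (simple_root R i).

(* The simple reflections are involutions, so the elements of W(D_n) are exactly
   the values [word_prod R w] of words. *)
Definition word_prod (R : realType) (n : nat) (w : seq 'I_n) : 'M[R]_n :=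
  \prod_(i <- w) simple_refl R i.

(* w is a reduced word for g, i.e. w belongs to Red(g). *)
Definition Red (R : realType) (n : nat) (g : 'M[R]_n) (w : seq 'I_n) : Prop :=
  word_prod R w = g /\
  forall w' : seq 'I_n, word_prod R w' = g -> (size w <= size w')%N.

(* g is an element of W(D_n) of Coxeter length l. *)
Definition has_length (R : realType) (n : nat) (g : 'M[R]_n) (l : nat) : Prop :=
  exists2 w : seq 'I_n, Red g w & size w = l.

Definition is_longest (R : realType) (n : nat) (g : 'M[R]_n) : Prop :=
  exists2 l : nat, has_length g l &
    forall (h : 'M[R]_n) (k : nat), has_length h k -> (k <= l)%N.

Definition is_order (R : realType) (n : nat) (g : 'M[R]_n) (m : nat) : Prop :=
  [/\ (0 < m)%N, g ^+ m = 1 &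
      forall k : nat, (0 < k < m)%N -> g ^+ k <> 1].

(* The word i j i j ... with m letters. *)
Fixpoint alternating (n : nat) (m : nat) (i j : 'I_n) : seq 'I_n :=
  if m is m'.+1 then i :: alternating m' j i else [::].

Definition braid_move (R : realType) (n : nat) (r r' : seq 'I_n) : Prop :=
  exists (u v : seq 'I_n) (i j : 'I_n) (m : nat),
    [/\ i != j, is_order (simple_refl R i * simple_refl R j) m,
        r = u ++ alternating m i j ++ v &
        r' = u ++ alternating m j i ++ v].

Definition word_edge (R : realType) (n : nat) (g : 'M[R]_n)
    (r r' : seq 'I_n) : Prop :=
  [/\ Red g r, Red g r' & braid_move R r r'].

Fixpoint walk (R : realType) (n : nat) (g : 'M[R]_n) (k : nat)
    (r r' : seq 'I_n) : Prop :=
  if k is k'.+1 then exists2 q, word_edge g r q & walk g k' q r' else r = r'.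

(* d(r, r') = d in the graph G(g). *)
Definition is_dist (R : realType) (n : nat) (g : 'M[R]_n)
    (r r' : seq 'I_n) (d : nat) : Prop :=
  walk g d r r' /\ forall k : nat, walk g k r r' -> (d <= k)%N.

Definition hyper (R : realType) (n : nat) (a : 'cV[R]_n) : {vspace 'cV[R]_n} :=
  lker (linfun (mulmx a^T : 'cV[R]_n -> 'cV[R]_1)).

Lemma mem_hyper (R : realType) (n : nat) (a x : 'cV[R]_n) :
  (x \in hyper a) = (dot a x == 0).
Proof.
rewrite memv_ker lfunE /= /dot; apply/eqP/eqP => [->|h]; first by rewrite mxE.
by rewrite [LHS]mx11_scalar h raddf0.
Qed.

Definition arrangement (R : realType) (n : nat) : seq {vspace 'cV[R]_n} :=
  [seq hyper a | a <- pos_roots R n].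

(* The duplicate-free list of all codimension-two intersections of subfamilies
   of the arrangement; a subfamily is given by a bit mask. *)
Definition L2 (R : realType) (n : nat) : seq {vspace 'cV[R]_n} :=
  undup [seq X <- [seq (\bigcap_(H <- mask (m : seq bool) (arrangement R n)) H)%VS
                     | m : (size (arrangement R n)).-tuple bool]
           | (\dim X + 2 == n)%N].

Definition fund_chamber (R : realType) (n : nat) : set 'cV[R]_n :=
  [set x | forall a, a \in pos_roots R n -> 0 < dot x a]%classic.

Arguments fund_chamber : clear implicits.

Definition gallery (R : realType) (n : nat) (r : seq 'I_n) :
    seq (set 'cV[R]_n) :=
  [seq [set word_prod R (take k r) *m x | x in fund_chamber R n]%classic
     | k <- iota 0 (size r).+1].

(* The chamber of the localized arrangement A_X into which the chamber D of A
   descends.  Chambers of A_X live in the quotient by X; they are represented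
   here by their preimages in the ambient space, i.e. by the chambers of the
   subarrangement of the hyperplanes containing X.  (The image of D in the
   quotient is in general a proper subset of that chamber.) *)
Definition local_chamber (R : realType) (n : nat) (X : {vspace 'cV[R]_n})
    (D : set 'cV[R]_n) : set 'cV[R]_n :=
  [set y | forall a, a \in pos_roots R n -> (X <= hyper a)%VS ->
           forall x, D x -> Num.sg (dot y a) = Num.sg (dot x a)]%classic.

Fixpoint remove_repeats (T : eqType) (s : seq T) : seq T :=
  if s is x :: s' then
    if ohead s' == Some x then remove_repeats s' else x :: remove_repeats s'
  else [::].

(* The gallery r/X: the chambers of A_X visited by r, where steps that cross no
   hyperplane containing X are contracted. *)
Definition local_gallery (R : realType) (n : nat) (X : {vspace 'cV[R]_n})
    (r : seq 'I_n) : seq (set 'cV[R]_n) :=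
  remove_repeats [seq local_chamber X D | D <- gallery R r].

Definition L2_sep (R : realType) (n : nat) (r r' : seq 'I_n) :
    seq {vspace 'cV[R]_n} :=
  [seq X <- L2 R n | local_gallery X r != local_gallery X r'].

Definition L2_accessible (R : realType) (n : nat) (g : 'M[R]_n)
    (r : seq 'I_n) : Prop :=
  Red g r /\
  forall r' : seq 'I_n, Red g r' -> is_dist g r r' (size (L2_sep R r r')).

(* Main.v *)
From Stdlib Require Import String Ascii.
Require Import Defs.
From mathcomp Require Import all_boot all_order all_algebra.
From mathcomp Require Import boolp classical_sets reals.
From mathcomp Require Import ring lra.
Set Implicit Arguments.
Unset Strict Implicit.
Unset Printing Implicit Defensive.
Import Order.TTheory GRing.Theory Num.Theory.
Local Open Scope ring_scope.

(** The gallery of a word crosses the hyperplanes of the positive roots one after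
the other, so a reduced word of [w0] is an order on the twenty positive roots
([gallery_roots]).  Its localization at a flat X of codimension two is the order of
the roots vanishing on X ([local_galleryE]).  A braid move reverses a block of
consecutive roots, namely two orthogonal roots or the three roots of an A2; such a
block, a flip, is the set of all roots vanishing on one flat, and no other flat
notices the move ([braid_flip], [flip_over]).

Let [r] be accessible and let [r'] be another reduced word.  A geodesic from [r] to
[r'] ends with a move from some [q] to [r'], and accessibility forces [q] to be
separated from [r] by fewer flats than [r'] is.  Hence this last move undoes a flip
of [r'] whose roots [r] crosses in a different order ([accessible_flip]).  So [r] is
not accessible as soon as some [r'] other than [r] is stuck: every flip of [r'] lists
its roots in the order in which [r] crosses them, and [r'] is a local minimum of the
distance to [r] measured by separated flats.

It remains to find a stuck word for every [r].  Only two facts about [r] are used: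
it orders the roots linearly, and a root a + b always lies between a and b
([root_order], [before_root_order]).  A word with few flips, say four to six, is
stuck for many orders, because few comparisons have to agree.  A decision tree
([cover_tree]) compares pairs of roots and closes the known comparisons under the two
facts; every leaf names a word all of whose flips have been decided in its favour,
while at least one comparison has been decided against it, so that it differs from
[r].  The diagram automorphism exchanging the letters 0 and 1 and the reversal of the
order permute the stuck words, and therefore two of the comparisons may be fixed
beforehand ([exists_stuck]).

The passage from matrices to orders rests on the parity of the number of crossings,
which gives the sign of each root on each chamber ([sg_word_prod]), and on the
exchange property ([exchange]).  They show that the reduced words of [w0] are exactly
the words of length twenty whose gallery crosses no hyperplane twice
([gallery_roots_perm], [Red_longest]). *)

(** * Lists *)

Lemma all_iota (P : nat -> bool) n : all P (iota 0 n) -> forall a, (a < n)%N -> P a.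
Proof. by move/allP => h a ha; apply: h; rewrite mem_iota. Qed.

Lemma all_iota2 (P : nat -> nat -> bool) m n :
  all (fun a => all (P a) (iota 0 n)) (iota 0 m) ->
  forall a b, (a < m)%N -> (b < n)%N -> P a b.
Proof. by move=> h a b ha hb; exact: (all_iota (all_iota h ha) hb). Qed.

Lemma filter_infix (T : eqType) (A M B : seq T) : uniq (A ++ M ++ B) ->
  filter (mem M) (A ++ M ++ B) = M.
Proof.
rewrite uniq_catCA cat_uniq !filter_cat => /and3P[_ /hasPn h _].
have E s : {subset s <= A ++ B} -> filter (mem M) s = [::].
  move=> hs; rewrite -(filter_pred0 s); apply: eq_in_filter => a /hs /h /negbTE.
  by rewrite inE.
rewrite (E A) ?(E B) ?cats0; try by move=> a ha; rewrite mem_cat ha ?orbT.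
by apply/all_filterP/allP.
Qed.

Definition before (T : eqType) (s : seq T) : rel T :=
  fun x y => (index x s < index y s)%N.

Lemma sorted_before (T : eqType) (s : seq T) : uniq s -> sorted (before s) s.
Proof.
case: s => // x0 s us; apply/(sortedP x0) => i hi; rewrite /before !index_uniq //.
exact: ltnW.
Qed.

Lemma filter_sorted_before (T : eqType) (s M : seq T) :
    uniq s -> {subset M <= s} -> sorted (before s) M ->
  filter (mem M) s = M.
Proof.
move=> us hM sM.
have tr : transitive (before s) by move=> y x z; apply: ltn_trans.
apply: (@irr_sorted_eq _ (before s)) => //.
- by move=> x; rewrite /before ltnn.
- exact: sorted_filter (sorted_before us).
- by move=> x; rewrite mem_filter inE /=; case: (boolP (x \in M)) => // /hM ->.
Qed.

(** The accumulator makes the comparison with the prefixes of a filtered list an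
induction. *)
Fixpoint prefix_map (A T : Type) (F : seq A -> T) acc s : seq T :=
  F acc :: (if s is b :: s' then prefix_map F (rcons acc b) s' else [::]).

Lemma prefix_mapE A T (F : seq A -> T) acc s :
  prefix_map F acc s = [seq F (acc ++ take k s) | k <- iota 0 (size s).+1].
Proof.
elim: s acc => [|b s IH] acc; first by rewrite /= cats0.
have -> : iota 0 (size (b :: s)).+1 = 0%N :: map succn (iota 0 (size s).+1).
  by rewrite -(iotaDl 1 0).
rewrite map_cons take0 cats0 -map_comp [LHS]/= IH; congr (_ :: _).
by apply: eq_map => k; rewrite /= cat_rcons.
Qed.

(** Appending an element outside [p] does not change the value of [F], so it only
creates a repetition. *)
Lemma remove_repeats_prefix A (T : eqType) (F : seq A -> T) (p : pred A) :
  (forall s, F (filter p s) = F s) -> forall acc s,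
  remove_repeats (prefix_map F acc s) =
  remove_repeats (prefix_map F (filter p acc) (filter p s)).
Proof.
move=> hF acc s.
have hd acc' s' : ohead (prefix_map F acc' s') = Some (F acc') by case: s'.
elim: s acc => [|b s IH] acc; first by rewrite /= hF.
rewrite [LHS]/= hd [filter p (b :: s)]/= IH filter_rcons.
case hp: (p b) => /=; first by rewrite hd hF -(hF (rcons acc b)) filter_rcons hp.
by rewrite -(hF (rcons acc b)) filter_rcons hp hF eqxx.
Qed.

(** * The scalar product, words and walks in any dimension *)

Section AnyDimension.
Context (R : realType) (n : nat).
Local Notation vec := 'cV[R]_n.

Lemma dotE (x y : vec) : dot x y = \sum_i x i 0 * y i 0.
Proof. by rewrite /dot mxE; apply: eq_bigr => i _; rewrite mxE. Qed.

Lemma dotC (x y : vec) : dot x y = dot y x.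
Proof. by rewrite !dotE; apply: eq_bigr => i _; rewrite mulrC. Qed.

Lemma dotDl (x y z : vec) : dot (x + y) z = dot x z + dot y z.
Proof. by rewrite /dot linearD mulmxDl mxE. Qed.

Lemma dotZl c (x z : vec) : dot (c *: x) z = c * dot x z.
Proof. by rewrite /dot linearZ -scalemxAl mxE. Qed.

Lemma dotDr (x y z : vec) : dot z (x + y) = dot z x + dot z y.
Proof. by rewrite dotC dotDl !(dotC z). Qed.

Lemma dotZr c (x z : vec) : dot z (c *: x) = c * dot z x.
Proof. by rewrite dotC dotZl dotC. Qed.

Lemma dotNr (x z : vec) : dot z (- x) = - dot z x.
Proof. by rewrite -scaleN1r dotZr mulN1r. Qed.

Lemma dotNl (x z : vec) : dot (- x) z = - dot x z.
Proof. by rewrite dotC dotNr dotC. Qed.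

Lemma dot_self_eq0 (x : vec) : dot x x = 0 -> x = 0.
Proof.
rewrite dotE => /eqP h; apply/colP => i; rewrite mxE; apply/eqP.
rewrite -sqrf_eq0; move: h; rewrite psumr_eq0; last by move=> j _; rewrite -expr2 sqr_ge0.
by move/allP/(_ i (mem_index_enum _)); rewrite expr2.
Qed.

Lemma mulmx_col_inj (A B : 'M[R]_n) : (forall x : vec, A *m x = B *m x) -> A = B.
Proof.
move=> h; apply/matrixP => i j.
by have := congr1 (fun M : vec => M i 0) (h (delta_mx j 0)); rewrite -!colE !mxE.
Qed.

Lemma word_prod_cons (i : 'I_n) w : word_prod R (i :: w) = simple_refl R i *m word_prod R w.
Proof. by rewrite /word_prod big_cons. Qed.

Lemma word_prod_cat (u v : seq 'I_n) : word_prod R (u ++ v) = word_prod R u *m word_prod R v.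
Proof. by rewrite /word_prod big_cat. Qed.

Lemma word_prod_nil : word_prod R [::] = 1%:M :> 'M_n.
Proof. by rewrite /word_prod big_nil. Qed.

Lemma exists_Red (w : seq 'I_n) : exists m, Red (word_prod R w) m.
Proof.
pose P k := `[< exists2 m : seq 'I_n, word_prod R m = word_prod R w & size m = k >].
have [|k /asboolP[m em sm] hk] := @ex_minnP P.
  by exists (size w); apply/asboolP; exists w.
exists m; split=> // w' ew'; rewrite sm; apply: hk; apply/asboolP; by exists w'.
Qed.

Lemma walk_last (g : 'M[R]_n) k r r' : walk g k.+1 r r' ->
  exists2 q, walk g k r q & word_edge g q r'.
Proof.
elim: k r => [|k IH] r; first by case=> q e <-; exists r.
by case=> q e /IH[p wqp ep]; exists p => //; exists q.
Qed.

End AnyDimension.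

(** * The root system D5 in integer coordinates *)

Definition unit_coords (k : nat) : seq int := [seq (j == k)%:R | j <- iota 0 5].

Definition lincomb (c : int) (u : seq int) (d : int) (v : seq int) : seq int :=
  [seq c * u`_k + d * v`_k | k <- iota 0 5].

Definition idot (u v : seq int) : int :=
  foldr (fun k s => u`_k * v`_k + s) 0 (iota 0 5).

(** The twenty positive roots get the numbers 0 to 19: [e_j - e_i] and then [e_j + e_i],
for [j = 1, ..., 4] and [i = 0, ..., j - 1] in lexicographic order.  The tables are
stored evaluated, so that the finite verifications look their entries up. *)
Definition coords_table : seq (seq int) :=
  Eval vm_compute in
  flatten [seq flatten [seq [:: lincomb 1 (unit_coords j) (-1) (unit_coords i);
                               lincomb 1 (unit_coords j) 1 (unit_coords i)] | i <- iota 0 j]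
          | j <- iota 0 5].

Definition coords (a : nat) : seq int := nth [::] coords_table a.

(** The simple roots [e_0 + e_1] and [e_i - e_(i-1)] in this numbering. *)
Definition alpha (i : nat) : nat := nth 0%N [:: 1; 0; 4; 10; 18]%N i.

(** The number of the positive root proportional to the reflection of root [a] in
root [b]. *)
Definition refl_index (b a : nat) : nat :=
  let v := lincomb 1 (coords a) (- idot (coords b) (coords a)) (coords b) in
  if v \in coords_table then index v coords_table else index (lincomb (-1) v 0 v) coords_table.

Definition act_table : seq (seq nat) :=
  Eval vm_compute in
  [seq [seq refl_index (alpha i) a | a <- iota 0 20] | i <- iota 0 5].

Definition act (i a : nat) : nat := nth 0%N (nth [::] act_table i) a.

Definition third_table : seq (seq (option nat)) :=
  Eval vm_compute in
  [seq [seq if (a != b) && (idot (coords a) (coords b) != 0) then Some (refl_index a b)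
            else None | b <- iota 0 20] | a <- iota 0 20].

(** The remaining positive root of the rank two subsystem spanned by [a] and [b], if
there is one: two distinct positive roots are orthogonal or lie in a unique A2. *)
Definition third (a b : nat) : option nat := nth None (nth [::] third_table a) b.

(** The [k]-th entry is the root of the hyperplane between the chambers of the prefixes
of length [k - 1] and [k], that is, the simple root of the [k]-th letter moved by the
letters in front of it. *)
Fixpoint crossings (w : seq nat) : seq nat :=
  if w is i :: w' then alpha i :: [seq act i a | a <- crossings w'] else [::].

(** A block of consecutive crossings that a braid move can reverse. *)
Definition is_flip (M : seq nat) : bool :=
  match M with
  | [:: x; y] => third x y == None
  | [:: x; y; z] => third x y == Some z
  | _ => false
  end.

Definition flips (s : seq nat) : seq (seq nat) :=
  [seq M <- [seq take l (drop k s) | k <- iota 0 (size s), l <- [:: 2; 3]%N]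
  | is_flip M].

Section Geometry.
Context (R : realType).
Local Notation vec := 'cV[R]_5.

Definition emb (v : seq int) : vec := \col_i (v`_i)%:~R.
Definition rootv (a : nat) : vec := emb (coords a).

Lemma nth_lincomb c u d v k : (k < 5)%N -> (lincomb c u d v)`_k = c * u`_k + d * v`_k.
Proof. by move=> hk; rewrite (nth_map 0%N) ?size_iota // nth_iota. Qed.

Lemma emb_lincomb c u d v : emb (lincomb c u d v) = c%:~R *: emb u + d%:~R *: emb v.
Proof.
by apply/colP => i; rewrite !mxE nth_lincomb ?ltn_ord // intrD !intrM.
Qed.

Lemma dot_emb u v : dot (emb u) (emb v) = (idot u v)%:~R.
Proof.
rewrite dotE !big_ord_recl big_ord0 /idot /= !intrD !intrM !mxE.
by rewrite /bump /=.
Qed.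

Lemma dot_rootv a b : dot (rootv a) (rootv b) = (idot (coords a) (coords b))%:~R.
Proof. exact: dot_emb. Qed.

Lemma dot_rootv_self a : (a < 20)%N -> dot (rootv a) (rootv a) = 2.
Proof.
move=> ha; rewrite dot_rootv.
suff -> : idot (coords a) (coords a) = 2 by [].
by apply/eqP; move: a ha; apply: all_iota; vm_compute.
Qed.

Lemma reflection_rootv b x : (b < 20)%N ->
  reflection (rootv b) *m x = x - dot (rootv b) x *: rootv b.
Proof.
move=> hb; rewrite reflectionE dot_rootv_self //; congr (_ - _ *: _).
by rewrite mulrAC divff ?mul1r // pnatr_eq0.
Qed.

Lemma reflection_sym b (x y : vec) : (b < 20)%N ->
  dot (reflection (rootv b) *m x) y = dot x (reflection (rootv b) *m y).
Proof.
move=> hb; rewrite !reflection_rootv // dotDl dotDr dotNl dotNr dotZl dotZr.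
by rewrite (dotC x (rootv b)) mulrC.
Qed.

Lemma reflection_invol b : (b < 20)%N -> reflection (rootv b) *m reflection (rootv b) = 1%:M.
Proof.
move=> hb; apply/matrixP => i j.
have E : forall x : vec, reflection (rootv b) *m (reflection (rootv b) *m x) = x.
  move=> x; rewrite !reflection_rootv // dotDr dotNr dotZr dot_rootv_self //.
  rewrite -addrA -opprD -scalerDl.
  by rewrite [X in X *: _](_ : _ = 0) ?scale0r ?subr0 //; ring.
have := congr1 (fun M : vec => M i 0) (E (delta_mx j 0)).
by rewrite mulmxA -colE !mxE eqxx andbT.
Qed.

Lemma alpha_lt i : (i < 5)%N -> (alpha i < 20)%N.
Proof. by move: i; apply: all_iota. Qed.

Lemma basis_emb k : basis_vec R 5 k = emb (unit_coords k).
Proof.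
apply/colP => i; rewrite !mxE (nth_map 0%N) ?size_iota ?ltn_ord // nth_iota ?ltn_ord //.
by rewrite add0n; case: (_ == _).
Qed.

Lemma emb_add u v : emb u + emb v = emb (lincomb 1 u 1 v).
Proof. by rewrite emb_lincomb !scale1r. Qed.

Lemma emb_sub u v : emb u - emb v = emb (lincomb 1 u (-1) v).
Proof. by rewrite emb_lincomb scale1r scaleN1r. Qed.

Lemma simple_rootE (i : 'I_5) : simple_root R i = rootv (alpha i).
Proof.
rewrite /simple_root !basis_emb emb_add emb_sub -(fun_if emb); congr emb.
by apply/eqP; case: i => i hi /=; move: i hi; apply: all_iota; vm_compute.
Qed.

Lemma perm_pos_roots : perm_eq (pos_roots R 5) [seq rootv a | a <- iota 0 20].
Proof.
pose L := [seq lincomb 1 (unit_coords p.2) (-1) (unit_coords p.1)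
     | p <- [seq (i, j) | i <- iota 0 5, j <- iota 0 5] & (p.1 < p.2)%N] ++
  [seq lincomb 1 (unit_coords p.2) 1 (unit_coords p.1)
     | p <- [seq (i, j) | i <- iota 0 5, j <- iota 0 5] & (p.1 < p.2)%N].
have -> : pos_roots R 5 = [seq emb v | v <- L].
  rewrite map_cat -!map_comp; congr (_ ++ _); apply: eq_map => p /=;
  by rewrite ?emb_add ?emb_sub !basis_emb ?emb_add ?emb_sub.
rewrite (map_comp emb coords); apply: perm_map.
by vm_compute.
Qed.

Lemma mem_pos_roots x : reflect (exists2 a, (a < 20)%N & x = rootv a) (x \in pos_roots R 5).
Proof.
rewrite (perm_mem perm_pos_roots); apply: (iffP mapP) => [] [a ha ->]; exists a => //.
  by rewrite mem_iota in ha.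
by rewrite mem_iota.
Qed.

Lemma act_lt i a : (i < 5)%N -> (a < 20)%N -> (act i a < 20)%N.
Proof. by move: i a; apply: all_iota2. Qed.

Lemma act_invol i a : (i < 5)%N -> (a < 20)%N -> act i (act i a) = a.
Proof. by move=> hi ha; apply/eqP; move: i a hi ha; apply: all_iota2. Qed.

Lemma act_alpha i : (i < 5)%N -> act i (alpha i) = alpha i.
Proof. by move=> hi; apply/eqP; move: i hi; apply: all_iota. Qed.

Lemma simple_refl_rootv (i : 'I_5) a : (a < 20)%N ->
  simple_refl R i *m rootv a = (-1) ^+ (a == alpha i) *: rootv (act i a).
Proof.
move=> ha; rewrite /simple_refl simple_rootE reflection_rootv ?alpha_lt // dot_rootv.
have -> : (-1) ^+ (a == alpha i) *: rootv (act i a) =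
  emb (lincomb ((-1) ^+ (a == alpha i)) (coords (act i a)) 0 [::]).
  by rewrite emb_lincomb scale0r addr0 rmorphXn /= rmorphN1.
rewrite -scaleNr -mulrNz -[rootv a]scale1r -[1]/(1%:~R) -emb_lincomb; congr emb.
by apply/eqP; case: i => i hi /=; move: i a hi ha; apply: all_iota2; vm_compute.
Qed.

End Geometry.

(** * Words, galleries and the order of the crossings *)

Definition gallery_roots (w : seq 'I_5) : seq nat := crossings [seq val i | i <- w].

Definition word_act (u : seq 'I_5) (a : nat) : nat := foldr (fun i => act (val i)) a u.

Section Words.
Context (R : realType).
Local Notation vec := 'cV[R]_5.
Local Notation rootv := (@rootv R).
Local Notation wp := (word_prod R).

Lemma gallery_roots_cons i w :
  gallery_roots (i :: w) = alpha i :: [seq act i a | a <- gallery_roots w].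
Proof. by []. Qed.

Lemma size_gallery_roots w : size (gallery_roots w) = size w.
Proof. by elim: w => //= i w IH; rewrite /gallery_roots /= size_map IH. Qed.

Lemma gallery_roots_cat u v :
  gallery_roots (u ++ v) = gallery_roots u ++ [seq word_act u a | a <- gallery_roots v].
Proof.
elim: u => [|i u IH] /=; first by rewrite map_id.
by rewrite !gallery_roots_cons IH map_cat -map_comp.
Qed.

Lemma take_gallery_roots k w : take k (gallery_roots w) = gallery_roots (take k w).
Proof.
rewrite -{1}(cat_take_drop k w) gallery_roots_cat.
case: (leqP k (size w)) => hk; first by rewrite take_size_cat // size_gallery_roots size_takel.
by rewrite drop_oversize ?(ltnW hk) // cats0 !take_oversize ?size_gallery_roots // ltnW.
Qed.

Lemma gallery_roots_lt w : all (fun a => a < 20)%N (gallery_roots w).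
Proof.
elim: w => //= i w IH; rewrite /= alpha_lt //=.
by apply/allP => b /mapP[a /(allP IH) ha ->]; apply: act_lt.
Qed.

Lemma simple_refl_sym (i : 'I_5) (x y : vec) :
  dot (simple_refl R i *m x) y = dot x (simple_refl R i *m y).
Proof. by rewrite /simple_refl simple_rootE reflection_sym ?alpha_lt. Qed.

Lemma simple_refl_invol (i : 'I_5) : simple_refl R i *m simple_refl R i = 1%:M.
Proof. by rewrite /simple_refl simple_rootE reflection_invol ?alpha_lt. Qed.

Lemma count_act i s a : all (fun a => a < 20)%N s -> (i < 5)%N -> (a < 20)%N ->
  count_mem a [seq act i b | b <- s] = count_mem (act i a) s.
Proof.
move=> hs hi ha; rewrite count_map; apply: eq_in_count => b /(allP hs) hb /=.
by apply/eqP/eqP => [<-|->]; rewrite act_invol.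
Qed.

(** A letter [i] in front of the word moves the test root [a] to [act i a], with a change
of sign exactly when [a] is the simple root of [i], which is then a new crossing. *)
Lemma dot_word_prod w (x : vec) a : (a < 20)%N ->
  exists2 b, (b < 20)%N & dot (wp w *m x) (rootv a) =
    (-1) ^+ count_mem a (gallery_roots w) * dot x (rootv b).
Proof.
elim: w a => [|i w IH] a ha; first by exists a => //; rewrite word_prod_nil mul1mx mul1r.
rewrite word_prod_cons -mulmxA simple_refl_sym simple_refl_rootv // dotZr.
have [b hb ->] := IH _ (act_lt (ltn_ord i) ha); exists b => //.
by rewrite mulrA -exprD gallery_roots_cons /= count_act ?gallery_roots_lt // eq_sym.
Qed.

(** Half the sum of the positive roots; any point of the fundamental chamber would do. *)
Definition weyl_vector : vec := emb R [:: 0; 1; 2; 3; 4].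

Lemma weyl_vector_chamber : fund_chamber R 5 weyl_vector.
Proof.
move=> _ /mem_pos_roots[a ha ->]; rewrite dot_emb ltr0z.
by move: a ha; apply: all_iota; vm_compute.
Qed.

(** Every occurrence of [a] among the crossings changes the side of the hyperplane of
[a] on which the gallery runs. *)
Lemma sg_word_prod w (x : vec) a : (a < 20)%N -> fund_chamber R 5 x ->
  Num.sg (dot (wp w *m x) (rootv a)) = (-1) ^+ odd (count_mem a (gallery_roots w)).
Proof.
move=> ha hx; have [b hb ->] := dot_word_prod w x ha.
rewrite sgrM sgrX sgrN1 signr_odd gtr0_sg ?mulr1 //.
by apply: hx; apply/mem_pos_roots; exists b.
Qed.

(** The local chamber reached after the crossings [s]; only the parity of the number of
crossings of each hyperplane through [X] matters. *)
Definition signs_chamber (X : {vspace vec}) (s : seq nat) : set vec :=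
  [set y | forall a, (a < 20)%N -> (X <= hyper (rootv a))%VS ->
     Num.sg (dot y (rootv a)) = (-1) ^+ odd (count_mem a s)]%classic.

Lemma local_chamberE X w :
  local_chamber X [set wp w *m x | x in fund_chamber R 5]%classic =
  signs_chamber X (gallery_roots w).
Proof.
apply/seteqP; split => y /= hy.
- move=> a ha hX; rewrite -(sg_word_prod w ha weyl_vector_chamber).
  apply: hy => //; first by apply/mem_pos_roots; exists a.
  by exists weyl_vector => //; apply: weyl_vector_chamber.
- move=> _ /mem_pos_roots[a ha ->] hX _ [x hx <-].
  by rewrite hy // sg_word_prod.
Qed.

(** Crossings of hyperplanes that do not contain [X] leave the local chamber unchanged,
and the removal of repetitions erases them. *)
Lemma local_galleryE X w :
  local_gallery X w = remove_repeats
    (prefix_map (signs_chamber X) [::] [seq a <- gallery_roots w | X <= hyper (rootv a)]%VS).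
Proof.
rewrite -[[::]]/(filter (fun a => X <= hyper (rootv a))%VS [::]) -remove_repeats_prefix; last first.
  move=> s; apply/seteqP; split => y /= hy a ha hX; rewrite hy // count_filter;
  by do 3!congr (_ _); apply: eq_count => b /=; case: eqP => // ->; rewrite hX.
congr remove_repeats.
rewrite prefix_mapE /gallery -map_comp size_gallery_roots; apply: eq_map => k /=.
by rewrite local_chamberE take_gallery_roots.
Qed.

End Words.

(** * Reduced words and the longest element *)

Section Coxeter.
Context (R : realType).
Local Notation vec := 'cV[R]_5.
Local Notation rootv := (@rootv R).
Local Notation wp := (@word_prod R 5).

Lemma reflection_conj (S : 'M[R]_5) (b c : nat) (e : bool) :
    (forall x y : vec, dot (S *m x) y = dot x (S *m y)) -> S *m S = 1%:M ->
    (b < 20)%N -> (c < 20)%N -> S *m rootv b = (-1) ^+ e *: rootv c ->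
  S *m reflection (rootv b) = reflection (rootv c) *m S.
Proof.
move=> symS invS hb hc SV; apply: mulmx_col_inj => x.
have E : rootv c = (-1) ^+ e *: (S *m rootv b) by rewrite SV scalerA -expr2 sqrr_sign scale1r.
rewrite -[LHS]mulmxA -[RHS]mulmxA !reflection_rootv // mulmxBr; congr (_ - _).
rewrite E dotZl symS mulmxA invS mul1mx -scalemxAr scalerA.
by rewrite mulrAC -expr2 sqrr_sign mul1r.
Qed.

Lemma simple_refl_conj (i : 'I_5) b : (b < 20)%N ->
  simple_refl R i *m reflection (rootv b) = reflection (rootv (act i b)) *m simple_refl R i.
Proof.
move=> hb; apply: (reflection_conj _ _ hb (act_lt (ltn_ord i) hb) (simple_refl_rootv R i hb)).
  exact: simple_refl_sym.
exact: simple_refl_invol.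
Qed.

(** The exchange property: reflecting in a crossed hyperplane deletes the letter that
crosses it.  By induction on the word, since conjugating the reflection in [b] by the
first letter [i] gives the reflection in [act i b]. *)
Lemma exchange a w : a \in gallery_roots w ->
  exists2 w' : seq 'I_5, size w = (size w').+1 & wp w' = reflection (rootv a) *m wp w.
Proof.
elim: w a => // i w IH a; rewrite gallery_roots_cons inE => /predU1P[->|/mapP[b hb ->]].
  exists w => //; rewrite word_prod_cons mulmxA /simple_refl simple_rootE.
  by rewrite reflection_invol ?alpha_lt // mul1mx.
have b20 := allP (gallery_roots_lt w) _ hb.
have [w' sw' ew'] := IH _ hb.
exists (i :: w'); first by rewrite /= sw'.
by rewrite !word_prod_cons ew' !mulmxA simple_refl_conj.
Qed.

Lemma uniq_act (i : 'I_5) s : all (fun a => a < 20)%N s -> uniq s ->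
  uniq [seq act i a | a <- s].
Proof.
move=> hs us; rewrite map_inj_in_uniq // => a b ha hb /(congr1 (act i)).
by rewrite !act_invol ?(allP hs).
Qed.

(** If a hyperplane is crossed twice, two letters can be deleted: the exchange property
removes the second crossing at the cost of a reflection that cancels the first one. *)
Lemma Red_uniq (g : 'M[R]_5) w : Red g w -> uniq (gallery_roots w).
Proof.
case=> <- {g}; elim: w => // i w IH hmin; rewrite gallery_roots_cons /=.
apply/andP; split.
- apply/mapP => -[b hb E].
  have b20 := allP (gallery_roots_lt w) _ hb.
  have {E} E : b = alpha i by rewrite -(act_invol (ltn_ord i) b20) -E act_alpha.
  have [w' sw' ew'] := exchange hb.
  have : wp w' = wp (i :: w) by rewrite ew' E word_prod_cons /simple_refl simple_rootE.
  by move/hmin; rewrite /= sw' ltnNge leqnSn.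
- apply: uniq_act; first exact: gallery_roots_lt.
  apply: IH => w' E; have := hmin (i :: w'); rewrite !word_prod_cons E => /(_ erefl).
  by rewrite ltnS.
Qed.

(** The parities of the crossings are the signs of the roots on the last chamber, hence
depend on the group element only. *)
Lemma parity_word_prod w w' a : wp w = wp w' -> (a < 20)%N ->
  odd (count_mem a (gallery_roots w)) = odd (count_mem a (gallery_roots w')).
Proof.
move=> E ha; have := sg_word_prod w ha (@weyl_vector_chamber R).
rewrite E sg_word_prod //; last exact: weyl_vector_chamber.
by move/signr_inj.
Qed.

Lemma gallery_roots_sub w : {subset gallery_roots w <= iota 0 20}.
Proof. by move=> a /(allP (gallery_roots_lt w)); rewrite mem_iota. Qed.

(** A reduced word crosses no hyperplane twice, so if all parities are even it is
empty. *)
Lemma even_word_prod w : (forall a, (a < 20)%N -> ~~ odd (count_mem a (gallery_roots w))) ->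
  wp w = 1%:M.
Proof.
move=> hev; have [m hm] := exists_Red R w.
have um := Red_uniq hm; case: hm => em _.
case: m em um => [|i m] em um; first by rewrite -em word_prod_nil.
have a20 := alpha_lt (ltn_ord i).
have := hev _ a20; rewrite -(parity_word_prod em a20) count_uniq_mem //.
by rewrite gallery_roots_cons mem_head.
Qed.

(** Each root is crossed an odd number of times, hence at least once, by every word with
the same product. *)
Lemma uniq_Red w : uniq (gallery_roots w) -> Red (wp w) w.
Proof.
move=> uw; split=> // w' E; rewrite -(size_gallery_roots w) -(size_gallery_roots w').
apply: uniq_leq_size => // a ha; rewrite -has_pred1 has_count.
have a20 := allP (gallery_roots_lt w) _ ha.
have := parity_word_prod E a20; rewrite (count_uniq_mem _ uw) ha.
by case: count.
Qed.

Lemma gallery_roots_perm w : uniq (gallery_roots w) -> size w = 20%N ->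
  perm_eq (gallery_roots w) (iota 0 20).
Proof.
move=> uw sw; apply: uniq_perm => //.
by apply: (uniq_min_size uw (@gallery_roots_sub w) _).2; rewrite size_gallery_roots sw.
Qed.

Lemma word_prod_revl w : wp (rev w) *m wp w = 1%:M.
Proof.
elim: w => [|i w IH]; first by rewrite word_prod_nil mulmx1.
rewrite rev_cons -cats1 word_prod_cat !word_prod_cons word_prod_nil mulmx1 mulmxA.
by rewrite -(mulmxA (wp (rev w))) simple_refl_invol mulmx1.
Qed.

Lemma word_prod_revr w : wp w *m wp (rev w) = 1%:M.
Proof. by rewrite -{1}(revK w) word_prod_revl. Qed.

Lemma Red_rev w : Red (wp w) w -> Red (wp (rev w)) (rev w).
Proof.
case=> _ hw; split=> // w' E; rewrite size_rev -(size_rev w'); apply: hw.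
by rewrite -[LHS]mulmx1 -(word_prod_revl w) mulmxA -E word_prod_revl mul1mx.
Qed.

Definition longest_word : seq 'I_5 :=
  [seq inord i | i <- [:: 0; 2; 3; 4; 1; 2; 3; 4; 0; 2; 3; 4; 1; 2; 3; 4; 0; 2; 3; 4]%N].

Lemma map_val_inord (w : seq nat) : all (fun i => i < 5)%N w ->
  [seq val i | i <- [seq inord i : 'I_5 | i <- w]] = w.
Proof.
move=> /allP hw; rewrite -map_comp map_id_in // => i hi /=.
by rewrite inordK // hw.
Qed.

Lemma uniq_longest_word : uniq (gallery_roots longest_word).
Proof. by rewrite /gallery_roots map_val_inord. Qed.

(** Reduced words have at most twenty letters, because they cross distinct hyperplanes,
and [longest_word] reaches this bound. *)
Lemma longest_size (w0 : 'M[R]_5) r : is_longest w0 -> Red w0 r -> size r = 20%N.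
Proof.
move=> [l [w hw <-] hl] hr; apply/eqP; rewrite eqn_leq; apply/andP; split.
  rewrite -size_gallery_roots -[X in (_ <= X)%N](size_iota 0 20).
  apply: uniq_leq_size (@gallery_roots_sub r).
  exact: Red_uniq hr.
have : (20 <= size w)%N.
  apply: (hl (wp longest_word)); exists longest_word => //; apply: uniq_Red.
  exact: uniq_longest_word.
by move/leq_trans; apply; apply: hw.2; exact: hr.1.
Qed.

Lemma sg_longest w (x : vec) a : uniq (gallery_roots w) -> size w = 20%N -> fund_chamber R 5 x ->
  (a < 20)%N -> Num.sg (dot (wp w *m x) (rootv a)) = -1.
Proof.
move=> uw sw hx ha; rewrite sg_word_prod // count_uniq_mem //.
by rewrite (perm_mem (gallery_roots_perm uw sw)) mem_iota ha expr1.
Qed.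

(** Both [r] and [w] send the fundamental chamber to its opposite, so the inverse of [r]
followed by [w] crosses every hyperplane an even number of times and is trivial. *)
Lemma Red_longest (w0 : 'M[R]_5) r w : is_longest w0 -> Red w0 r ->
  uniq (gallery_roots w) -> size w = 20%N -> Red w0 w.
Proof.
move=> hw0 hr uw sw; suff -> : w0 = wp w by apply: uniq_Red.
have sr := longest_size hw0 hr.
have hr' : Red (wp r) r by rewrite hr.1.
have urr := Red_uniq (Red_rev hr').
suff E : wp (rev r ++ w) = 1%:M.
  by rewrite -hr.1 -[LHS]mulmx1 -E word_prod_cat mulmxA word_prod_revr mul1mx.
apply: even_word_prod => a ha.
have := sg_word_prod (rev r ++ w) ha (@weyl_vector_chamber R).
rewrite word_prod_cat -mulmxA; set y := wp w *m _.
have hy : fund_chamber R 5 (- y).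
  move=> _ /mem_pos_roots[b hb ->]; rewrite dotNl oppr_gt0 -sgr_lt0.
  by rewrite sg_longest // ?ltrN10 //; apply: weyl_vector_chamber.
rewrite -[wp (rev r) *m y]opprK -mulmxN dotNl sgrN sg_longest ?size_rev // opprK.
by case: odd => //= /eqP; rewrite expr1 eq_sym -subr_eq0 -opprD oppr_eq0 (pnatr_eq0 _ 2).
Qed.

End Coxeter.

(** * Flats of codimension two *)

Definition gram_table : seq (seq int) :=
  Eval vm_compute in
  [seq [seq idot (coords a) (coords b) | b <- iota 0 20] | a <- iota 0 20].
Definition gram (a b : nat) : int := nth 0 (nth [::] gram_table a) b.

(** The Gram determinant of three roots, all of squared length 2. *)
Definition gram_det (x y z : nat) : int :=
  let: (p, q, r) := (gram x y, gram x z, gram y z) in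
  8 + 2 * (p * q * r) - 2 * (p * p + q * q + r * r).

(** The positive roots in the linear span of two distinct ones. *)
Definition plane (x y : nat) : seq nat :=
  x :: y :: (if third x y is Some z then [:: z] else [::]).

Lemma gramE a b : (a < 20)%N -> (b < 20)%N -> idot (coords a) (coords b) = gram a b.
Proof. by move=> ha hb; apply/eqP; move: a b ha hb; apply: all_iota2; vm_compute. Qed.

Lemma gram_det_neq0 x y z : (x < 20)%N -> (y < 20)%N -> (z < 20)%N ->
  x != y -> z \notin plane x y -> gram_det x y z != 0.
Proof.
pose ok x y z := [|| x == y, z \in plane x y | gram_det x y z != 0].
have chk : all (fun x => all (fun y => all (ok x y) (iota 0 20)) (iota 0 20)) (iota 0 20).
  by vm_compute.
move=> hx hy hz; have := all_iota (all_iota2 chk hx hy) hz.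
by rewrite /ok => /or3P[->|->|->].
Qed.

Lemma plane_lincomb x y z : (x < 20)%N -> (y < 20)%N -> third x y = Some z ->
  exists c d, coords z = lincomb c (coords x) d (coords y).
Proof.
have chk : all (fun x => all (fun y => if third x y is Some z then
   has (fun c => has (fun d => coords z == lincomb c (coords x) d (coords y)) [:: 1; -1]) [:: 1; -1]
   else true) (iota 0 20)) (iota 0 20) by vm_compute.
move=> hx hy E; have := all_iota2 chk hx hy; rewrite E => /hasP[c _ /hasP[d _ /eqP h]].
by exists c, d.
Qed.

Section Flats.
Context (R : realType).
Local Notation vec := 'cV[R]_5.
Local Notation rootv := (@rootv R).
Local Notation over X := (fun a => X <= hyper (rootv a))%VS.

Lemma plane_over (X : {vspace vec}) x y z : (x < 20)%N -> (y < 20)%N ->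
  over X x -> over X y -> z \in plane x y -> over X z.
Proof.
move=> hx hy Xx Xy; rewrite !inE => /or3P[/eqP->|/eqP->|] //.
case E : (third x y) => [t|//]; rewrite inE => /eqP ->.
have [c [d h]] := plane_lincomb hx hy E.
apply/subvP => v hv; rewrite mem_hyper /rootv h emb_lincomb dotDl !dotZl.
move/subvP/(_ _ hv): Xx; move/subvP/(_ _ hv): Xy; rewrite !mem_hyper => /eqP -> /eqP ->.
by rewrite !mulr0 addr0.
Qed.

(** In a linear relation between the roots, taking scalar products with each of them
gives a linear system whose determinant is the Gram determinant. *)
Lemma gram_det_free x y z : (x < 20)%N -> (y < 20)%N -> (z < 20)%N ->
  gram_det x y z != 0 -> free [:: rootv x; rootv y; rootv z].
Proof.
move=> hx hy hz hd; apply: (introT (@freeP _ _ _ (in_tuple [:: rootv x; rootv y; rootv z]))) => k.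
rewrite !big_ord_recl big_ord0 /= addr0 => E.
have D t : k ord0 * dot (rootv x) t + (k (lift ord0 ord0) * dot (rootv y) t
     + k (lift ord0 (lift ord0 ord0)) * dot (rootv z) t) = 0.
  by rewrite -!dotZl -!dotDl E -(scale0r 0) dotZl mul0r.
move: {E}(D (rootv x)) (D (rootv y)) (D (rootv z)).
rewrite !dot_rootv_self // (dotC (rootv y) (rootv x)) (dotC (rootv z) (rootv x)).
rewrite (dotC (rootv z) (rootv y)) !dot_rootv !gramE //.
move: hd; rewrite -(intr_eq0 R) /gram_det.
set p := gram x y; set q := gram x z; set r := gram y z.
set c1 := k _; set c2 := k _; set c3 := k _.
rewrite !(intrD, intrM, intrN) => hd e1 e2 e3.
(* The multipliers of the three equations are cofactors of the Gram matrix. *)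
have K1 : c1 = 0.
  apply: (mulfI hd); rewrite mulr0.
  rewrite -[RHS](_ : (4 - r%:~R ^+ 2) * 0 + (q%:~R * r%:~R - 2 * p%:~R) * 0
    + (p%:~R * r%:~R - 2 * q%:~R) * 0 = 0 :> R); last by ring.
  by rewrite -{1}e1 -{1}e2 -{1}e3; ring.
have K2 : c2 = 0.
  apply: (mulfI hd); rewrite mulr0.
  rewrite -[RHS](_ : (q%:~R * r%:~R - 2 * p%:~R) * 0 + (4 - q%:~R ^+ 2) * 0
    + (p%:~R * q%:~R - 2 * r%:~R) * 0 = 0 :> R); last by ring.
  by rewrite -{1}e1 -{1}e2 -{1}e3; ring.
have K3 : c3 = 0.
  apply: (mulfI hd); rewrite mulr0.
  rewrite -[RHS](_ : (p%:~R * r%:~R - 2 * q%:~R) * 0 + (p%:~R * q%:~R - 2 * r%:~R) * 0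
    + (4 - p%:~R ^+ 2) * 0 = 0 :> R); last by ring.
  by rewrite -{1}e1 -{1}e2 -{1}e3; ring.
move=> i; case: (unliftP ord0 i) => [j ->|->] //; case: (unliftP ord0 j) => [l ->|->] //.
by rewrite (ord1 l).
Qed.

(** The span of the three roots is orthogonal to [X] and has dimension three, while the
ambient space has dimension five. *)
Lemma dim_over (X : {vspace vec}) x y z :
  (x < 20)%N -> (y < 20)%N -> (z < 20)%N ->
  over X x -> over X y -> over X z -> gram_det x y z != 0 -> (\dim X <= 2)%N.
Proof.
move=> hx hy hz Xx Xy Xz hd.
set U := <<[:: rootv x; rootv y; rootv z]>>%VS.
have dU : \dim U = 3%N by move/eqP: (gram_det_free hx hy hz hd).
have UX : (U :&: X = 0)%VS.
  apply/eqP; rewrite -subv0; apply/subvP => v; rewrite memv_cap => /andP[vU vX].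
  have : (U <= hyper v)%VS.
    apply/span_subvP => u; rewrite mem_hyper dotC !inE.
    by case/or3P=> /eqP ->; rewrite -mem_hyper;
      [move/subvP: Xx | move/subvP: Xy | move/subvP: Xz]; apply.
  by move/subvP/(_ _ vU); rewrite mem_hyper => /eqP/dot_self_eq0 ->; rewrite mem0v.
have := dimvS (subvf (U + X)); rewrite (dimv_disjoint_sum UX) dU dimvf dim_matrix.
by move=> h; rewrite -(leq_add2l 3); exact: h.
Qed.

(** The roots vanishing on a flat of codimension two form a rank two subsystem, which is
determined by any two of its elements. *)
Lemma over_plane (X : {vspace vec}) x y z : X \in L2 R 5 ->
  (x < 20)%N -> (y < 20)%N -> (z < 20)%N -> x != y ->
  over X x -> over X y -> over X z = (z \in plane x y).
Proof.
rewrite mem_undup mem_filter => /andP[/eqP dX _] hx hy hz xy Xx Xy.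
apply/idP/idP => [Xz|]; last exact: plane_over.
apply/negPn/negP => /(gram_det_neq0 hx hy hz xy) /(dim_over hx hy hz Xx Xy Xz).
by rewrite -(leq_add2r 2) dX.
Qed.

End Flats.

(** * Braid moves and flips *)

Definition even_roots (w : seq nat) : bool :=
  all (fun a => ~~ odd (count_mem a (crossings w))) (iota 0 20).

Lemma third_act i x y : (i < 5)%N -> (x < 20)%N -> (y < 20)%N ->
  third (act i x) (act i y) = omap (act i) (third x y).
Proof.
pose ok i x y := third (act i x) (act i y) == omap (act i) (third x y).
have chk : all (fun i => all (fun x => all (ok i x) (iota 0 20)) (iota 0 20)) (iota 0 5).
  by vm_compute.
by move=> hi hx hy; apply/eqP; exact: (all_iota (all_iota2 chk hi hx) hy).
Qed.

Lemma third_rot x y z : (x < 20)%N -> (y < 20)%N -> third x y = Some z ->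
  [/\ (z < 20)%N, third x z = Some y & third y z = Some x].
Proof.
pose ok x y := if third x y is Some z then
  [&& (z < 20)%N, third x z == Some y & third y z == Some x] else true.
have chk : all (fun x => all (ok x) (iota 0 20)) (iota 0 20) by vm_compute.
move=> hx hy E; have := all_iota2 chk hx hy.
by rewrite /ok E => /and3P[? /eqP-> /eqP->].
Qed.

Lemma third_sym x y : (x < 20)%N -> (y < 20)%N -> third x y = third y x.
Proof. by move=> hx hy; apply/eqP; move: x y hx hy; apply: all_iota2; vm_compute. Qed.

(** Being a flip only depends on the rank two subsystem, not on the order of its roots,
and is preserved by the action of the letters. *)
Lemma is_flip_rev M : all (fun a => a < 20)%N M -> is_flip M -> is_flip (rev M).
Proof.
case: M => [|x [|y [|z [|? ?]]]] //=; rewrite /rev /=.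
  by case/and3P=> hx hy _; rewrite third_sym.
case/and4P=> hx hy hz _ /eqP /(third_rot hx hy)[_ _ h].
by rewrite third_sym // h.
Qed.

Lemma is_flip_act i M : (i < 5)%N -> all (fun a => a < 20)%N M ->
  is_flip M -> is_flip [seq act i a | a <- M].
Proof.
move=> hi; case: M => [|x [|y [|z [|? ?]]]] //=.
  by case/and3P=> hx hy _; rewrite third_act //; case: third.
by case/and4P=> hx hy hz _; rewrite third_act // => /eqP ->.
Qed.

Lemma is_flip_word u M : all (fun a => a < 20)%N M ->
  is_flip M -> is_flip [seq word_act u a | a <- M].
Proof.
move=> hM fM; elim: u => [|i u IH]; first by rewrite map_id.
rewrite (map_comp (act i) (word_act u)); apply: is_flip_act => //.
apply/allP => _ /mapP[a /(allP hM) ha ->]; elim: {IH} u => //= j u.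
exact: act_lt.
Qed.

Lemma mem_flips A M B : is_flip M -> M \in flips (A ++ M ++ B).
Proof.
move=> fM; rewrite mem_filter fM; apply/allpairsPdep; exists (size A), (size M).
have sM : size M \in [:: 2; 3]%N by case: M fM => [|x [|y [|z [|? ?]]]].
split=> //; last by rewrite drop_size_cat // take_size_cat.
rewrite mem_iota add0n !size_cat -[X in (X < _)%N]addn0 ltn_add2l.
by case: (M) sM.
Qed.

(** The order of the product of two distinct simple reflections; see
[is_order_pair]. *)
Definition pair_order (i j : nat) : nat :=
  if third (alpha i) (alpha j) is None then 2 else 3.

(** Everything needed about two letters: the order of their product (by the parities of
the crossings of its powers), and the braid relation, whose two sides act equally on
the roots and list the crossings of one flip in opposite orders. *)
Definition dihedral_spec (i j : nat) : bool :=
  if third (alpha i) (alpha j) is None then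
    [&& even_roots [:: i; j; i; j], ~~ even_roots [:: i; j],
        crossings [:: j; i] == rev (crossings [:: i; j]), is_flip (crossings [:: i; j]) &
        all (fun a => act i (act j a) == act j (act i a)) (iota 0 20)]
  else
    [&& even_roots [:: i; j; i; j; i; j], ~~ even_roots [:: i; j],
        ~~ even_roots [:: i; j; i; j],
        crossings [:: j; i; j] == rev (crossings [:: i; j; i]), is_flip (crossings [:: i; j; i]) &
        all (fun a => act i (act j (act i a)) == act j (act i (act j a))) (iota 0 20)].

Lemma dihedralP i j : (i < 5)%N -> (j < 5)%N -> i != j -> dihedral_spec i j.
Proof.
have chk : all (fun i => all (fun j => (i == j) || dihedral_spec i j) (iota 0 5)) (iota 0 5).
  by vm_compute.
by move=> hi hj /negbTE ne; have := all_iota2 chk hi hj; rewrite ne.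
Qed.

Section Moves.
Context (R : realType).
Local Notation vec := 'cV[R]_5.
Local Notation rootv := (@rootv R).
Local Notation wp := (@word_prod R 5).
Local Notation over X := (fun a => X <= hyper (rootv a))%VS.

Lemma word_prod_eq1 (w : seq 'I_5) : wp w = 1%:M <-> even_roots [seq val i | i <- w].
Proof.
split=> [h | /allP h]; last first.
  by apply: even_word_prod => a ha; apply: h; rewrite mem_iota.
apply/allP => a; rewrite mem_iota /= => ha.
by rewrite (@parity_word_prod R w [::]) // word_prod_nil.
Qed.

Lemma is_order_pair (i j : 'I_5) m : i != j ->
  is_order (simple_refl R i * simple_refl R j) m -> m = pair_order i j.
Proof.
move=> ne; set g := _ * _; case=> m0 gm gmin.
have g1 : g ^+ 1 = 1 <-> even_roots [:: val i; val j].
  by rewrite -(word_prod_eq1 [:: i; j]) /word_prod !big_cons big_nil mulr1.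
have g2 : g ^+ 2 = 1 <-> even_roots [:: val i; val j; val i; val j].
  by rewrite -(word_prod_eq1 [:: i; j; i; j]) /word_prod !big_cons big_nil mulr1 expr2 !mulrA.
have g3 : g ^+ 3 = 1 <-> even_roots [:: val i; val j; val i; val j; val i; val j].
  by rewrite -(word_prod_eq1 [:: i; j; i; j; i; j]) /word_prod !big_cons big_nil mulr1
    exprS expr2 !mulrA.
have := dihedralP (ltn_ord i) (ltn_ord j) ne; rewrite /dihedral_spec /pair_order.
case: third => [_|] /and5P[e /negP n1].
- move=> /negP n2 _ _; move: m m0 gm gmin => [|[|[|[|m]]]] // _.
  + by move/g1.
  + by move/g2.
  + by move=> _ /(_ 3%N isT); case; apply/g3.
- move=> _ _ _; move: m m0 gm gmin => [|[|[|m]]] // _.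
  + by move/g1.
  + by move=> _ /(_ 2%N isT); case; apply/g2.
Qed.

Lemma gallery_roots_insert u z v : gallery_roots (u ++ z ++ v) = gallery_roots u ++
  [seq word_act u a | a <- gallery_roots z] ++
  [seq word_act u (word_act z a) | a <- gallery_roots v].
Proof. by rewrite !gallery_roots_cat map_cat -map_comp. Qed.

(** Both sides of the braid relation act in the same way on the crossings that follow,
so the move only reverses the crossings of the block. *)
Lemma braid_flip r r' : braid_move R r r' -> exists A M B,
  [/\ gallery_roots r = A ++ M ++ B, gallery_roots r' = A ++ rev M ++ B & is_flip M].
Proof.
case=> u [v [i [j [m [ne /(is_order_pair ne) -> -> ->]]]]].
exists (gallery_roots u).
pose z := alternating (pair_order i j) i j.
pose z' := alternating (pair_order i j) j i.
exists [seq word_act u a | a <- gallery_roots z].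
exists [seq word_act u (word_act z a) | a <- gallery_roots v].
have := dihedralP (ltn_ord i) (ltn_ord j) ne; rewrite /dihedral_spec /pair_order => D.
have [fz rz az] : [/\ is_flip (gallery_roots z), gallery_roots z' = rev (gallery_roots z) &
    forall a, (a < 20)%N -> word_act z' a = word_act z a].
  move: D; rewrite /z /z' /pair_order; case: third => [_|].
  - case/and5P=> _ _ _ /eqP rz /andP[fz /allP az]; split=> // a ha.
    by apply/esym/eqP/az; rewrite mem_iota.
  - case/and5P=> _ _ /eqP rz fz /allP az; split=> // a ha.
    by apply/esym/eqP/az; rewrite mem_iota.
rewrite -/z -/z' !gallery_roots_insert rz map_rev; split=> //.
- do 2!congr (_ ++ _); apply/eq_in_map => a /(allP (gallery_roots_lt v)) ha.
  by rewrite az.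
- by apply: is_flip_word => //; apply: gallery_roots_lt.
Qed.

(** A flat contained in at most one hyperplane of a flip does not notice its reversal.
A flat of codimension two contained in two of them is the flat of the flip. *)
Lemma flip_over (X : {vspace vec}) M : X \in L2 R 5 -> is_flip M ->
  uniq M -> all (fun a => a < 20)%N M ->
  (size (filter (over X) M) <= 1)%N \/
  (forall a, (a < 20)%N -> over X a = (a \in M)).
Proof.
move=> hX fM uM aM; case: (leqP (size (filter (over X) M)) 1) => h; [by left|right].
move=> a ha; move: M fM uM aM h => [|x [|y [|z [|? ?]]]] //=.
- move=> /eqP th /andP[]; rewrite inE => xy _ /and3P[hx hy _].
  case Xx: (over X x); case Xy: (over X y) => // _.
  by rewrite (over_plane hX hx hy ha xy Xx Xy) /plane th.
- move=> /eqP th /and3P[]; rewrite !inE negb_or => /andP[xy xz] yz _ /and4P[hx hy hz _] h.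
  have [_ th2 th3] := third_rot hx hy th.
  have E : over X x && over X y || over X x && over X z || over X y && over X z.
    by move: h; case: (over X x); case: (over X y); case: (over X z).
  case/orP: E => [/orP[]|] /andP[X1 X2].
  + by rewrite (over_plane hX hx hy ha xy X1 X2) /plane th !inE.
  + by rewrite (over_plane hX hx hz ha xz X1 X2) /plane th2 !inE; do 3!case: eqP.
  + by rewrite (over_plane hX hy hz ha yz X1 X2) /plane th3 !inE; do 3!case: eqP.
Qed.

Lemma local_gallery_filter (X : {vspace vec}) r r' :
  filter (over X) (gallery_roots r) = filter (over X) (gallery_roots r') ->
  local_gallery X r = local_gallery X r'.
Proof. by rewrite !local_galleryE => ->. Qed.

(** The last step of a geodesic from [r] to [r'] must bring the two words closer.  If
[r] agreed with [r'] on every flip of [r'], the step would leave all separating flats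
separating, and the distance could not drop. *)
Lemma accessible_flip (w0 : 'M[R]_5) r r' : is_longest w0 ->
  L2_accessible w0 r -> Red w0 r' -> r != r' ->
  exists2 M, M \in flips (gallery_roots r') & filter (mem M) (gallery_roots r) != M.
Proof.
move=> hw0 [hr hacc] hr' ne; apply: contrapT => hno.
have agree M : M \in flips (gallery_roots r') -> filter (mem M) (gallery_roots r) = M.
  by move=> hM; apply/eqP/negPn/negP => hn; apply: hno; exists M.
have [hwalk _] := hacc r' hr'.
case E : (size (L2_sep R r r')) hwalk => [|k]; first by move=> /= h; rewrite h eqxx in ne.
case/walk_last=> q wrq [hq _ hb].
have [_ /(_ _ wrq)] := hacc q hq.
apply/negP; rewrite -ltnNge -E; apply: uniq_leq_size; first by rewrite filter_uniq // undup_uniq.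
move=> X; rewrite !mem_filter => /andP[sX hX]; rewrite hX andbT.
apply: contra sX => /eqP sX; apply/eqP.
have [A [M [B [eq eq' fM]]]] := braid_flip hb.
have lM : all (fun a => a < 20)%N (rev M).
  by have := gallery_roots_lt r'; rewrite eq' !all_cat => /and3P[].
have fM' : is_flip (rev M) by apply: is_flip_rev => //; move: lM; rewrite all_rev.
have uM : uniq (rev M).
  by have := Red_uniq hr'; rewrite eq' !cat_uniq => /and3P[_ _ /andP[]].
have hM : rev M \in flips (gallery_roots r') by rewrite eq' mem_flips.
(* Either [X] does not notice the move, or it is the flat of the flip, on which [r] and
   [r'] agree. *)
case: (flip_over hX fM' uM lM) => h.
  rewrite sX; apply: local_gallery_filter; rewrite eq eq' !filter_cat filter_rev.
  move: h; rewrite filter_rev size_rev.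
  by case: (filter _ M) => [|? [|? ?]].
apply: local_gallery_filter.
have E1 w : filter (over X) (gallery_roots w) = filter (mem (rev M)) (gallery_roots w).
  by apply: eq_in_filter => a /(allP (gallery_roots_lt w)) ha; rewrite /= h.
rewrite !E1 (agree _ hM) eq' filter_infix // -eq'; exact: Red_uniq hr'.
Qed.

End Moves.

(** * The order of the roots along a reduced word *)

(** The sum stands in the middle of a triple, where every crossing order puts it. *)
Definition sums : seq (nat * nat * nat) :=
  Eval vm_compute in
  [seq t <- [seq (p, b) | p <- [seq (a, m) | a <- iota 0 20, m <- iota 0 20], b <- iota 0 20]
  | coords t.1.2 == lincomb 1 (coords t.1.1) 1 (coords t.2)].

(** The properties of the crossing order of a reduced word of [w0] that the search for a
stuck word uses. *)
Record root_order (lt : rel nat) : Prop := RootOrder {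
  root_order_irr : irreflexive lt;
  root_order_trans : transitive lt;
  root_order_total : forall x y, (x < 20)%N -> (y < 20)%N -> x != y -> lt x y || lt y x;
  root_order_between : forall a m b, (a, m, b) \in sums -> lt a m = lt m b }.

Lemma sumsP a m b : (a, m, b) \in sums ->
  [/\ (a < 20)%N, (m < 20)%N, (b < 20)%N & [/\ a != m, m != b & (b, m, a) \in sums]]
  /\ coords m = lincomb 1 (coords a) 1 (coords b).
Proof.
have : all (fun t : nat * nat * nat => let: (a, m, b) := t in
  [&& a < 20, m < 20, b < 20, a != m, m != b, (b, m, a) \in sums &
      coords m == lincomb 1 (coords a) 1 (coords b)]%N) sums by vm_compute.
by move/allP => h /h /and5P[-> -> -> -> /and3P[-> -> /eqP]].
Qed.

Section Order.
Context (R : realType).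
Local Notation rootv := (@rootv R).

(** If [m] were crossed first or last among [a], [m] and [b], then [a] and [b] would have
one sign and their sum [m] the other on the chamber just after the crossing of [m],
respectively just before it. *)
Lemma before_root_order r : uniq (gallery_roots r) -> size r = 20%N ->
  root_order (before (gallery_roots r)).
Proof.
move=> ur sr; have pr := gallery_roots_perm ur sr.
have inr x : (x < 20)%N -> x \in gallery_roots r by rewrite (perm_mem pr) mem_iota.
split.
- by move=> x; rewrite /before ltnn.
- by move=> y x z; apply: ltn_trans.
- move=> x y hx hy; rewrite /before -neq_ltn; apply: contra => /eqP/index_inj -> //; exact: inr.
move=> a m b /sumsP[[ha hm hb [am mb _]] E].
have EV y : dot y (rootv m) = dot y (rootv a) + dot y (rootv b).
  by rewrite /rootv E emb_lincomb !scale1r dotDr.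
pose y k := word_prod R (take k r) *m weyl_vector R.
have sgy k x : (x < 20)%N ->
    Num.sg (dot (y k) (rootv x)) = (-1) ^+ (index x (gallery_roots r) < k)%N.
  move=> hx; rewrite sg_word_prod //; last exact: weyl_vector_chamber.
  rewrite -take_gallery_roots count_uniq_mem ?take_uniq // in_take ?inr //.
  by case: ltnP.
have {}am : index a (gallery_roots r) != index m (gallery_roots r).
  by apply: contra am => /eqP/index_inj -> //; exact: inr.
have {}mb : index m (gallery_roots r) != index b (gallery_roots r).
  by apply: contra mb => /eqP/index_inj -> //; exact: inr.
rewrite /before; case: ltngtP am => // am _; case: ltngtP mb => // mb _.
- have := sgy (index m (gallery_roots r)) _ hm; have := sgy (index m (gallery_roots r)) _ ha.
  have := sgy (index m (gallery_roots r)) _ hb; rewrite am mb ltnn !expr1 expr0.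
  move=> /eqP; rewrite sgr_cp0 => hb0 /eqP; rewrite sgr_cp0 => ha0 /eqP.
  by rewrite sgr_cp0 EV => hm0; clear - hb0 ha0 hm0; lra.
- have := sgy (index m (gallery_roots r)).+1 _ hm; have := sgy (index m (gallery_roots r)).+1 _ ha.
  have := sgy (index m (gallery_roots r)).+1 _ hb; rewrite ltnSn.
  rewrite ![(_ < (index m _).+1)%N]leqNgt !ltnS am mb !expr0 expr1.
  move=> /eqP; rewrite sgr_cp0 => hb0 /eqP; rewrite sgr_cp0 => ha0 /eqP.
  by rewrite sgr_cp0 EV => hm0; clear - hb0 ha0 hm0; lra.
Qed.
End Order.

Section RootOrder.
Context (lt : rel nat) (ord : root_order lt).

Lemma root_order_asym x y : lt x y -> ~~ lt y x.
Proof.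
move=> xy; apply/negP => /(root_order_trans ord xy).
by rewrite (root_order_irr ord).
Qed.

Lemma root_orderN x y : (x < 20)%N -> (y < 20)%N -> x != y -> lt y x = ~~ lt x y.
Proof.
move=> hx hy xy; apply/idP/idP; first exact: root_order_asym.
by have := root_order_total ord hx hy xy; case: (lt x y).
Qed.

Lemma root_order_sum a m b : (a, m, b) \in sums ->
  [|| lt a m, lt m b | lt a b] -> lt a m && lt m b.
Proof.
move=> h; rewrite -(root_order_between ord h) andbb orbA orbb.
have [[ha hm hb [am mb h']] _] := sumsP h.
case/orP=> // ab; apply/negPn; rewrite -root_orderN //; apply/negP => ma.
move: (ma); rewrite -(root_order_between ord h') => bm.
by move/negP: (root_order_asym ab); apply; apply: (root_order_trans ord bm).
Qed.

End RootOrder.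

(** * Stuck words and their symmetries *)

Lemma flipsP s M : M \in flips s ->
  is_flip M /\ exists A B, s = A ++ M ++ B.
Proof.
rewrite mem_filter => /andP[fM /allpairsPdep[k [l [_ _ E]]]]; split=> //.
exists (take k s), (drop l (drop k s)).
by rewrite E !cat_take_drop.
Qed.

(** The diagram automorphism is induced by changing the sign of the first coordinate; on
the roots it exchanges [e_j - e_0] and [e_j + e_0]. *)
Definition letter_swap (i : nat) : nat := nth i [:: 1; 0]%N i.

Definition root_swap (a : nat) : nat :=
  nth a [:: 1; 0; 3; 2; 4; 5; 7; 6; 8; 9; 10; 11; 13; 12]%N a.

(** The last condition holds for all words of [w0], because [w0] acts on the roots as
minus the diagram automorphism; it provides the word that crosses the hyperplanes in
the reverse order. *)
Definition valid_word (w : seq nat) : bool :=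
  [&& all (fun i => i < 5)%N w, size w == 20, uniq (crossings w) &
      crossings (rev (map letter_swap w)) == rev (crossings w)].

(** Agreement on the flips makes [w] a local minimum of the distance to the word whose
crossing order is [lt]; the disagreement elsewhere makes it a different word. *)
Definition stuck (lt : rel nat) (w : seq nat) : Prop :=
  [/\ valid_word w, all (sorted lt) (flips (crossings w)) & ~~ sorted lt (crossings w)].

Lemma root_swapK : involutive root_swap.
Proof.
move=> a; have [ha|ha] := ltnP a 14; last by rewrite /root_swap !nth_default.
by apply/eqP; move: a ha; apply: all_iota.
Qed.

Lemma letter_swapK : involutive letter_swap.
Proof.
move=> i; have [hi|hi] := ltnP i 2; last by rewrite /letter_swap !nth_default.
by apply/eqP; move: i hi; apply: all_iota.
Qed.

Lemma root_swap_lt a : (a < 20)%N -> (root_swap a < 20)%N.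
Proof. by move: a; apply: all_iota. Qed.

Lemma letter_swap_lt i : (i < 5)%N -> (letter_swap i < 5)%N.
Proof. by move: i; apply: all_iota. Qed.

Lemma act_swap i a : (i < 5)%N -> (a < 20)%N ->
  act (letter_swap i) (root_swap a) = root_swap (act i a).
Proof. by move=> hi ha; apply/eqP; move: i a hi ha; apply: all_iota2; vm_compute. Qed.

Lemma alpha_swap i : (i < 5)%N -> alpha (letter_swap i) = root_swap (alpha i).
Proof. by move=> hi; apply/eqP; move: i hi; apply: all_iota; vm_compute. Qed.

Lemma third_swap x y : (x < 20)%N -> (y < 20)%N ->
  third (root_swap x) (root_swap y) = omap root_swap (third x y).
Proof. by move=> hx hy; apply/eqP; move: x y hx hy; apply: all_iota2; vm_compute. Qed.

Lemma crossings_lt w : all (fun i => i < 5)%N w -> all (fun a => a < 20)%N (crossings w).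
Proof.
elim: w => //= i w IH /andP[hi hw]; rewrite alpha_lt //=.
by apply/allP => b /mapP[a /(allP (IH hw)) ha ->]; apply: act_lt.
Qed.

Lemma crossings_swap w : all (fun i => i < 5)%N w ->
  crossings (map letter_swap w) = map root_swap (crossings w).
Proof.
elim: w => //= i w IH /andP[hi hw]; rewrite IH // alpha_swap // -!map_comp.
congr (_ :: _); apply/eq_in_map => a /(allP (crossings_lt hw)) ha /=.
exact: act_swap.
Qed.

Lemma is_flip_swap M : all (fun a => a < 20)%N M -> is_flip M -> is_flip (map root_swap M).
Proof.
case: M => [|x [|y [|z [|? ?]]]] //=.
  by case/and3P=> hx hy _; rewrite third_swap //; case: third.
by case/and4P=> hx hy hz _; rewrite third_swap // => /eqP ->.
Qed.

Lemma root_order_swap lt : root_order lt ->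
  root_order (relpre root_swap lt).
Proof.
move=> ord; split=> /=.
- by move=> x; apply: root_order_irr ord _.
- by move=> y x z; apply: (root_order_trans ord).
- move=> x y hx hy xy; apply: (root_order_total ord); rewrite ?root_swap_lt //.
  by rewrite (inj_eq (inv_inj root_swapK)).
- move=> a m b h; apply: (root_order_between ord).
  have : all (fun t : nat * nat * nat => (root_swap t.1.1, root_swap t.1.2, root_swap t.2)
    \in sums) sums by vm_compute.
  by move/allP/(_ _ h).
Qed.

Lemma root_order_dual lt : root_order lt -> root_order (fun x y => lt y x).
Proof.
move=> ord; split=> /=.
- exact: root_order_irr ord.
- by move=> y x z yx zy; apply: (root_order_trans ord zy yx).
- by move=> x y hx hy xy; rewrite orbC; apply: (root_order_total ord).
- move=> a m b /sumsP[[_ _ _ [_ _ h]] _]; by rewrite (root_order_between ord h).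
Qed.

Lemma stuck_swap lt w : stuck (relpre root_swap lt) w -> stuck lt (map letter_swap w).
Proof.
case=> /and4P[w5 sw uw /eqP rw] /allP fw nw.
have E := crossings_swap w5.
have w5' : all (fun i => i < 5)%N (map letter_swap w).
  by rewrite all_map; apply/allP => i /(allP w5) /letter_swap_lt.
split; rewrite ?E ?sorted_map //.
- rewrite /valid_word w5' size_map sw E map_inj_uniq ?uw /=; last exact: inv_inj root_swapK.
  rewrite -[map _ (map _ w)]map_comp (eq_map letter_swapK) map_id.
  rewrite -[rev (map root_swap _)]map_rev -rw -crossings_swap; last first.
    by move: w5'; rewrite all_rev.
  by rewrite map_rev -map_comp (eq_map letter_swapK) map_id.
- apply/allP => M /flipsP[fM [A [B eqM]]].
  have eq' : crossings w = map root_swap A ++ map root_swap M ++ map root_swap B.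
    by rewrite -!map_cat -eqM -map_comp (eq_map root_swapK) map_id.
  have lM : all (fun a => a < 20)%N M.
    have := crossings_lt w5'; rewrite E eqM !all_cat => /and3P[] //.
  have := fw _ _; rewrite eq' => /(_ _ (mem_flips _ _ (is_flip_swap lM fM))).
  by rewrite sorted_map; apply: sub_sorted => x y /=; rewrite !root_swapK.
Qed.

Lemma stuck_dual lt w : stuck (fun x y => lt y x) w -> stuck lt (rev (map letter_swap w)).
Proof.
case=> /and4P[w5 sw uw /eqP rw] /allP fw nw.
have w5' : all (fun i => i < 5)%N (rev (map letter_swap w)).
  by rewrite all_rev all_map; apply/allP => i /(allP w5) /letter_swap_lt.
split; rewrite ?rw ?rev_sorted //.
- rewrite /valid_word w5' size_rev size_map sw rw rev_uniq uw /= map_rev revK revK.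
  by rewrite -map_comp (eq_map letter_swapK) map_id.
- apply/allP => M /flipsP[fM [A [B eqM]]].
  have eq' : crossings w = rev B ++ rev M ++ rev A.
    by rewrite -!rev_cat -catA -eqM revK.
  have lM : all (fun a => a < 20)%N M.
    have := crossings_lt w5; rewrite eq' !all_cat !all_rev => /and3P[] //.
  have := fw _ _; rewrite eq' => /(_ _ (mem_flips _ _ (is_flip_rev lM fM))).
  by rewrite rev_sorted.
Qed.

(** * The decision tree *)

(** A relation on the root numbers, stored as a matrix; an entry that holds records that
the root of its row is crossed before the root of its column. *)
Definition knowledge := seq (seq bool).

Definition known (K : knowledge) (x y : nat) : bool := nth false (nth [::] K x) y.

Fixpoint orrow (r s : seq bool) : seq bool :=
  match r, s with
  | b :: r', c :: s' => (b || c) :: orrow r' s'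
  | [::], _ => s
  | _, [::] => r
  end.

(** Adds a comparison to a transitively closed relation and restores transitivity. *)
Definition learn (K : knowledge) (x y : nat) : knowledge :=
  if known K x y then K else
  let above := set_nth false (nth [::] K y) y true in
  [seq let row := nth [::] K p in
       if (p == x) || nth false row x then orrow row above else row | p <- iota 0 20].

(** A sum lies between its terms, so one comparison inside such a triple decides the
other two. *)
Definition learn_sums (K : knowledge) : knowledge :=
  foldl (fun K t => let: (a, m, b) := t in
    if [|| known K a m, known K m b | known K a b] then learn (learn K a m) m b else K)
    K sums.

(** Four rounds close all the branches of the tree below. *)
Definition learn_closed (K : knowledge) (x y : nat) : knowledge :=
  iter 4 learn_sums (learn K x y).

(** [Branch x y t1 t2] continues with [t1] if root [x] is crossed before root [y] and with
[t2] otherwise; a leaf spells a word by its letters. *)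
Inductive tree :=
  | Leaf of string
  | Absurd
  | Branch of nat & nat & tree & tree.

Fixpoint letters (s : string) : seq nat :=
  if s is String c s' then (nat_of_ascii c - 48)%N :: letters s' else [::].

Definition leaf_ok (K : knowledge) (w : seq nat) : bool :=
  let b := crossings w in
  [&& valid_word w, all (sorted (known K)) (flips b) &
      ~~ pairwise (fun x y => ~~ known K y x) b].

(** A leaf must name a word whose flips are all known to agree, and for which some pair
is known to be crossed in the opposite order.  A branch is absurd once a root is known
to precede itself. *)
Fixpoint covers (K : knowledge) (t : tree) {struct t} : bool :=
  match t with
  | Leaf s => leaf_ok K (letters s)
  | Absurd => has (fun x => known K x x) (iota 0 20)
  | Branch x y t1 t2 =>
      [&& (x < 20)%N, (y < 20)%N, x != y,
          covers (learn_closed K x y) t1 & covers (learn_closed K y x) t2]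
  end.

(** The two comparisons that the symmetries allow to fix. *)
Definition start : knowledge :=
  Eval vm_compute in learn_closed (learn_closed (nseq 20 (nseq 20 false)) 0 1) 4 8.

Definition sound (K : knowledge) (lt : rel nat) : Prop := forall x y, known K x y -> lt x y.

Lemma nth_orrow r s k : nth false (orrow r s) k = nth false r k || nth false s k.
Proof.
elim: r s k => [|b r IH] [|c s] [|k] //=; rewrite ?nth_nil ?orbF //.
Qed.

Lemma learn_sound K lt x y : transitive lt -> sound K lt -> lt x y -> sound (learn K x y) lt.
Proof.
move=> tr sK xy; rewrite /learn; case: ifP => // _ p q.
rewrite {1}/known; case: (ltnP p 20) => hp; last first.
  by rewrite (nth_default [::]) ?nth_nil // size_map size_iota.
rewrite (nth_map 0%N) ?size_iota // nth_iota // add0n.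
case: ifP => [hpx|_]; last exact: sK.
rewrite nth_orrow => /orP[/sK //|].
rewrite nth_set_nth /= => hq.
have yq : (q == y) || lt y q by move: hq; case: eqP => //= _ /sK.
have {hq} xq : lt x q by case/orP: yq => [/eqP-> //|]; apply: tr.
by case/orP: hpx => [/eqP-> //|/sK px]; apply: tr xq.
Qed.

Lemma learn_closed_sound K lt x y : root_order lt -> sound K lt -> lt x y ->
  sound (learn_closed K x y) lt.
Proof.
move=> ord sK xy; have tr := root_order_trans ord.
rewrite /learn_closed; elim: 4%N => [|n IH]; first exact: learn_sound.
rewrite iterS; move: (iter n _ _) IH => {sK}K sK.
rewrite /learn_sums.
have : {subset sums <= sums} by [].
elim: {1 3}sums K sK => [|[[a m] b] s IH] K sK hs //=.
apply: IH => [|t ht]; last by apply: hs; rewrite inE ht orbT.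
case: ifP => // h.
have /andP[am mb] : lt a m && lt m b.
  apply: (root_order_sum ord); first by apply: hs; rewrite mem_head.
  by case/or3P: h => /sK ->; rewrite ?orbT.
by apply: learn_sound => //; apply: learn_sound.
Qed.

Lemma leaf_stuck K lt w : root_order lt -> sound K lt -> leaf_ok K w -> stuck lt w.
Proof.
move=> ord sK /and3P[vw /allP hw nw]; split=> //.
  apply/allP => M /hw; apply: sub_sorted => x y; exact: sK.
apply: contra nw; rewrite (sorted_pairwise (root_order_trans ord)).
apply: sub_pairwise => x y xy; apply/negP => /sK.
by apply/negP; apply: root_order_asym.
Qed.

Lemma covers_stuck K lt t : root_order lt -> sound K lt -> covers K t ->
  exists w, stuck lt w.
Proof.
move=> ord; elim: t K => [s|| x y t1 IH1 t2 IH2] K sK.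
- by move/(leaf_stuck ord sK); exists (letters s).
- move=> h; have /hasP[x _ /sK] : has (fun x => known K x x) (iota 0 20) := h.
  by rewrite (root_order_irr ord).
- move=> /= /and5P[hx hy xy c1 c2].
  case/orP: (root_order_total ord hx hy xy) => h.
  + by apply: (IH1 _ _ c1); apply: learn_closed_sound.
  + by apply: (IH2 _ _ c2); apply: learn_closed_sound.
Qed.

(** The words at the leaves have at most six flips; each branch compares a pair of roots
that brings many such words close to being stuck, whatever the outcome. *)
Definition cover_tree : tree :=
  Branch 12 13 (Branch 10 11 (Branch 0 19 (Branch 5 6 Absurd (Branch 3 8 (Leaf
  "02312343201201320432") (Branch 1 17 (Leaf "32432102132432023120") (Branch 1
  19 Absurd (Branch 1 11 Absurd (Branch 3 9 (Leaf "43210231204320120320")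
  (Branch 4 6 (Leaf "32021321302143201234") (Branch 5 7 (Branch 0 17 (Branch 3
  19 (Leaf "02132432012013204320") (Branch 10 13 (Branch 4 12 (Branch 14 15
  (Leaf "02132102312432012034") (Leaf "02132432012013204320")) (Branch 2 15
  (Branch 1 14 (Leaf "12343201203201204321") (Branch 7 15 (Leaf
  "43214324302132432021") (Branch 6 15 (Branch 14 15 (Branch 16 17 (Branch 6
  18 (Leaf "02132102312432012034") (Leaf "32021321432102343120")) (Leaf
  "02132102312432012034")) (Branch 1 16 (Leaf "12343201203201204321") (Leaf
  "43021023210214320123"))) (Leaf "02132102432012343202")))) (Leaf
  "43214302302432120321"))) (Branch 2 15 (Leaf "43210432043243120321") (Leaf
  "02342312023423123402")))) (Leaf "02134210234120123420")) (Leaf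
  "43210234123023012032"))))))))) (Branch 5 6 Absurd (Branch 3 8 (Leaf
  "43210234012012321023") (Branch 1 10 Absurd (Branch 1 11 Absurd (Branch 5 7
  (Branch 4 6 (Leaf "43210234120320120320") (Leaf "02132102341231201234"))
  (Branch 4 6 (Branch 0 11 (Leaf "43210234021230230123") (Branch 1 17 (Leaf
  "02343210213210214320") (Branch 3 9 (Branch 2 8 (Leaf
  "43210234012032012032") (Leaf "43210234012032012302")) (Branch 6 7 (Leaf
  "43210234021230230123") (Leaf "43210234012302123023"))))) (Leaf
  "02312340231201234323")))))))) (Branch 4 19 (Branch 3 9 (Branch 2 8 (Branch
  5 7 (Branch 0 10 (Branch 0 11 (Branch 1 10 (Branch 8 9 (Branch 2 3 (Leaf
  "03201203210243201234") (Leaf "03201203201243201234")) (Branch 4 6 (Branch 9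
  17 (Leaf "43210214320432120320") (Branch 10 12 (Leaf "02143204321203204320")
  (Branch 7 17 Absurd (Branch 16 17 (Branch 5 6 (Branch 5 12 (Branch 5 18
  (Leaf "12342312302132034321") (Leaf "12342012032012304321")) (Leaf
  "02342102132102341320")) (Leaf "43210234132012320120")) (Branch 5 13 (Branch
  5 18 (Branch 10 13 (Leaf "43214023423023120321") (Branch 5 6 (Branch 4 5
  (Branch 1 19 (Leaf "02321021032143201234") (Leaf "43210234123201201320"))
  (Branch 8 16 (Leaf "32432102341230210320") (Branch 7 18 (Leaf
  "34234210231204321320") (Leaf "12342312302132034321")))) (Leaf
  "02321021302143201234"))) (Leaf "12342012032102304321")) (Leaf
  "12342012032102340321")))))) (Branch 16 17 (Leaf "43214324302341203201")
  (Branch 14 15 (Leaf "02132012312432012034") (Branch 5 6 (Branch 2 15 (Branch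
  10 13 (Branch 8 17 (Leaf "43210214320143213202") (Leaf
  "21432043212032043201")) (Leaf "43210432043243120321")) (Leaf
  "02132012314321320234")) (Leaf "20321302302143201234")))))) (Leaf
  "30231230213243201234")) (Branch 1 10 (Branch 3 8 (Branch 8 9 (Branch 2 3
  (Leaf "03201230210243201234") (Leaf "13210231201243201234")) (Branch 2 3
  (Leaf "03210230210243201234") (Leaf "13201231201243201234"))) (Leaf
  "03201230210243201234")) (Leaf "30231203213243201234"))) (Leaf
  "02132013213243201234")) (Branch 0 10 (Branch 8 9 (Branch 0 11 Absurd
  (Branch 1 10 (Branch 2 3 (Leaf "03201230210243201234") (Leaf
  "13210231201243201234")) (Leaf "30231203213243201234"))) Absurd) (Leaf
  "02312013213243201234"))) (Leaf "10213201231243201234")) (Branch 2 8 (Branch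
  1 10 (Branch 0 11 (Branch 2 3 (Branch 8 9 (Leaf "03201203210243201234")
  (Branch 0 19 (Branch 6 7 (Branch 4 5 (Leaf "03210232102143201234") (Branch 4
  6 (Leaf "03213202132143201234") (Branch 0 14 (Branch 2 15 (Branch 10 13
  (Branch 1 2 (Leaf "23210231202143201234") (Branch 4 12 (Branch 9 17 (Branch
  7 17 (Branch 10 12 (Branch 5 6 (Branch 11 15 (Leaf "23243210213204321320")
  (Leaf "02102343203212032043")) (Leaf "02343210213201243120")) (Leaf
  "23432132021321432021")) (Leaf "02143204321203204320")) (Leaf
  "02143204321203204320")) (Leaf "02134320123412312023"))) (Leaf
  "43210432043243120321")) (Leaf "02132012314321320234")) (Leaf
  "32130234120320123420")))) (Leaf "32012013210243201234")) (Leaf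
  "43210234132032120320"))) (Leaf "43210213201432132023")) (Leaf
  "03213203213243201234")) (Branch 0 11 (Branch 0 19 (Branch 5 6 (Branch 3 8
  (Leaf "20321032032143201234") (Leaf "23021032032143201234")) (Branch 4 6
  (Leaf "32021321302143201234") (Branch 3 8 (Leaf "02321023021243201234")
  (Branch 1 17 (Leaf "02432102143201243120") (Branch 16 17 (Branch 4 12 (Leaf
  "43202132130214320123") (Branch 14 15 (Branch 5 7 (Branch 5 12 Absurd
  (Branch 2 15 (Branch 10 13 (Branch 0 14 (Branch 5 13 (Branch 1 18 (Leaf
  "34023420123412023120") (Branch 3 18 (Leaf "02343201234120123120") (Branch 0
  16 (Leaf "02132012312432012034") (Leaf "32130234120320123420")))) (Leaf
  "02341201234123120234")) (Leaf "32021321432102343120")) (Leaf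
  "43210432043243120321")) (Leaf "43214324023423120321"))) (Leaf
  "43213023412302312023")) (Leaf "43021023214320123120"))) (Branch 2 15
  (Branch 1 19 Absurd (Branch 5 7 (Branch 14 15 (Leaf "02132012312432012034")
  (Branch 5 13 (Branch 10 13 (Branch 6 18 (Branch 5 10 (Branch 10 12 (Branch 3
  18 (Leaf "02432102143201243120") (Leaf "12302102342302301234")) (Branch 3 15
  (Leaf "43214324302132043201") (Branch 1 16 (Leaf "23021432041234123120")
  (Leaf "43021023214320123120")))) (Leaf "12343201203210204321")) (Leaf
  "43021023421320123120")) (Leaf "23021340234023120234")) Absurd)) (Leaf
  "43210234123023120323"))) Absurd)))))) (Leaf "43210234021230230123")) (Leaf
  "30213203213243201234"))) (Leaf "10231201231243201234"))) (Branch 3 8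
  (Branch 5 7 (Branch 0 17 (Branch 2 9 (Branch 6 7 (Branch 0 3 (Branch 4 7
  (Branch 3 9 (Branch 4 6 (Branch 4 5 (Leaf "02341230120123420320") (Branch 11
  15 (Leaf "43214320432134203201") (Branch 8 9 (Leaf "02102321021432012343")
  (Branch 7 16 (Leaf "43214320432341203201") (Branch 8 16 Absurd (Branch 2 19
  (Branch 6 16 (Leaf "32143210234321203201") (Branch 0 18 (Leaf
  "02134023402301234023") (Branch 16 17 (Branch 5 12 (Leaf
  "23210213204321023420") (Leaf "12340231021023421321")) (Leaf
  "12342012302102304321")))) (Leaf "43213432034234120321"))))))) (Leaf
  "43210234320321203201")) (Branch 4 5 (Leaf "12340231021023432132") (Branch 4
  6 (Branch 1 10 (Leaf "03213202132143201234") (Leaf "43210234321203213202"))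
  (Branch 10 13 (Leaf "32143202123432132021") (Branch 2 15 (Leaf
  "43210432043243120321") (Branch 5 19 (Branch 14 15 (Leaf
  "12340210230210234321") (Leaf "23210231204321023420")) (Leaf
  "12340231021023421321"))))))) (Leaf "43210234320132132021")) Absurd) (Branch
  0 3 (Leaf "43210234232102132021") Absurd)) (Leaf "43210234213201231201"))
  (Leaf "23412301201234320321")) (Leaf "02312012341231201234")) (Branch 5 7
  (Branch 0 17 (Branch 5 6 (Branch 3 9 (Leaf "43210234321230213202") (Leaf
  "43210234321203213202")) (Branch 14 15 (Leaf "12340210230210234321") (Branch
  1 16 (Leaf "32104320123432132021") (Leaf "43021023421320123120")))) (Leaf
  "23412301201234320321")) (Branch 14 15 (Leaf "12340210230210234321") (Leaf
  "43210234212302312023")))))) (Branch 10 11 (Branch 1 17 (Branch 4 19 (Branch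
  5 7 (Leaf "02343210213210214320") (Leaf "43201203204320123021")) Absurd)
  (Branch 5 19 (Leaf "23432012032012043201") (Branch 4 6 (Branch 0 4 (Branch 5
  7 (Leaf "12302341234021023423") (Leaf "43201234123023123023")) (Branch 5 7
  (Leaf "43201234120320120320") (Branch 8 17 (Branch 2 8 (Leaf
  "23432012032012043201") (Branch 3 9 (Leaf "43201234012032012302") (Branch 0
  19 (Leaf "02343210213210214320") (Branch 6 7 (Leaf "43201234021230230123")
  (Leaf "43201234021230231023"))))) (Leaf "21230234012340210234")))) (Branch 7
  17 (Leaf "43201234123023120323") (Leaf "21302340212340210234"))))) (Branch 3
  8 (Branch 4 19 (Branch 5 6 (Branch 1 10 (Branch 1 11 (Branch 2 8 (Branch 6 7
  (Branch 4 5 (Branch 0 19 (Leaf "32102132102143210234") (Leaf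
  "43201234320120320120")) (Branch 1 17 (Branch 3 9 (Branch 4 6 (Branch 8 17
  (Leaf "43201204321043201321") (Branch 0 4 (Branch 1 2 (Leaf
  "23210213202143210234") (Leaf "43201201321024320123")) Absurd)) (Leaf
  "32132021321043210234")) (Leaf "43201203210432032123")) (Branch 8 16 (Leaf
  "43201203210204320123") (Leaf "12012341231021023423")))) (Branch 2 3 (Leaf
  "32012013210243210234") (Leaf "32012013201243210234"))) Absurd) (Branch 2 9
  (Branch 9 17 (Leaf "43201204321432032132") (Branch 10 15 (Leaf
  "12324320123120432132") (Branch 4 7 (Branch 8 17 (Leaf
  "43201243243120321320") (Branch 10 12 (Leaf "02134320321203204320") (Branch
  4 15 (Branch 3 9 (Branch 2 8 (Branch 6 17 (Leaf "02132041234231230234")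
  (Branch 3 19 (Branch 7 17 Absurd (Branch 1 17 (Branch 4 5 (Leaf
  "02321021032143210234") (Branch 8 16 (Leaf "32432012341230213202") (Leaf
  "34234201231204321320"))) (Branch 4 5 (Branch 8 9 (Branch 2 3 (Branch 0 11
  (Leaf "03201203210243210234") (Leaf "03201230210243210234")) (Leaf
  "13210231201243210234")) (Leaf "43201231243201201320")) (Branch 6 7 (Branch
  1 19 (Leaf "43201203210204320123") (Leaf "43204321320321432012")) (Leaf
  "43201243210214320121"))))) (Leaf "43202432143234021320"))) (Leaf
  "43201234032012302102")) (Leaf "02341230120123420320")) (Leaf
  "23402310210234321320")))) Absurd))) (Leaf "13203213203243210234"))) (Leaf
  "12032103203243210234")) (Branch 1 10 (Branch 8 9 (Branch 1 11 Absurd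
  (Branch 0 19 (Leaf "20321302302143210234") (Branch 2 3 (Branch 0 11 (Leaf
  "03201203210243210234") (Leaf "03201230210243210234")) (Leaf
  "43201234032012302102")))) (Branch 0 4 (Leaf "02321023021243210234") (Branch
  0 19 (Leaf "02321021302143210234") (Leaf "12302341234021023423")))) (Leaf
  "12302103203243210234"))) (Branch 1 17 (Branch 2 9 (Branch 6 7 (Branch 4 7
  (Branch 2 15 (Leaf "32102132043123120234") (Branch 2 3 (Branch 5 19 (Branch
  9 17 (Leaf "43204321432340213201") (Branch 0 16 (Branch 3 19 (Leaf
  "23421021320432132034") (Leaf "43203432134234021320")) (Leaf
  "32102132043201234202"))) (Leaf "02032102340213210234")) (Leaf
  "43201234232012032120"))) (Leaf "43201234320132132021")) (Leaf
  "23201203212043210234")) (Leaf "43201234213201231201")) (Leaf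
  "02341201231201234320"))) (Branch 4 19 (Branch 2 9 (Branch 2 19 (Branch 1 17
  (Leaf "43201201321432012312") (Branch 3 9 (Branch 2 8 (Branch 0 11 (Branch 1
  10 (Leaf "03201203210243210234") (Leaf "30231230213243210234")) (Branch 1 10
  (Leaf "03201230210243210234") (Leaf "30231203213243210234"))) (Leaf
  "10213201231243210234")) (Branch 2 8 (Branch 5 6 (Branch 0 19 (Branch 1 10
  (Leaf "12032130230243210234") (Leaf "23021032032143210234")) (Leaf
  "02341230120123420320")) (Branch 4 6 (Branch 0 19 (Leaf
  "32021321302143210234") (Leaf "43201234021230230123")) (Leaf
  "02343210213201243120"))) (Leaf "10231201231243210234")))) (Branch 0 17
  Absurd (Leaf "23021023402310210234"))) (Leaf "10230210230243210234")) (Leaf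
  "23412012312012343201")))).

Lemma covers_cover_tree : covers start cover_tree.
Proof. by vm_compute. Qed.

Lemma start_sound lt : root_order lt -> lt 0%N 1%N -> lt 4%N 8%N -> sound start lt.
Proof.
move=> ord h1 h2.
have -> : start = learn_closed (learn_closed (nseq 20 (nseq 20 false)) 0 1) 4 8.
  by vm_compute.
apply: learn_closed_sound => //; apply: learn_closed_sound => // x y.
by rewrite /known !nth_nseq; case: ifP; rewrite ?nth_nseq ?nth_nil //; case: ifP.
Qed.

(** Reversing the order turns the comparison of the roots 4 and 8 around.  The diagram
automorphism fixes both of them and exchanges the roots 0 and 1. *)
Lemma exists_stuck lt : root_order lt -> exists w, stuck lt w.
Proof.
have base l : root_order l -> l 0%N 1%N -> l 4%N 8%N -> exists w, stuck l w.
  by move=> ord h1 h2; apply: covers_stuck ord (start_sound ord h1 h2) covers_cover_tree.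
have half l : root_order l -> l 4%N 8%N -> exists w, stuck l w.
  move=> ord h; case/orP: (root_order_total ord (isT : 0 < 20)%N (isT : 1 < 20)%N isT) => h1.
    exact: base.
  have [w hw] := base _ (root_order_swap ord) h1 h.
  by exists (map letter_swap w); apply: stuck_swap.
move=> ord; case/orP: (root_order_total ord (isT : 4 < 20)%N (isT : 8 < 20)%N isT) => h.
  exact: half.
have [w hw] := half _ (root_order_dual ord) h.
by exists (rev (map letter_swap w)); apply: stuck_dual.
Qed.

(** * No word is accessible *)

Theorem proposition5p2 (R : realType) (w0 : 'M[R]_5) (hw0 : is_longest w0) :
  ~ exists r : seq 'I_5, L2_accessible w0 r.
Proof.
case=> r acc; have hr := acc.1.
have ur := Red_uniq hr; have sr := longest_size hw0 hr.
have [w [/and4P[w5 /eqP sw uw _] /allP fw nw]] :=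
  exists_stuck (before_root_order R ur sr).
pose r' : seq 'I_5 := [seq inord i | i <- w].
have br' : gallery_roots r' = crossings w by rewrite /gallery_roots map_val_inord.
have hr' : Red w0 r'.
  by apply: (Red_longest hw0 hr); rewrite ?br' // size_map.
have ne : r != r'.
  by apply: contra nw => /eqP E; rewrite -br' -E sorted_before.
have [M] := accessible_flip hw0 acc hr' ne.
rewrite br' => hM /eqP; apply; apply: filter_sorted_before => //; last exact: fw.
move=> a ha; rewrite (perm_mem (gallery_roots_perm ur sr)) mem_iota /=.
have [_ [A [B E]]] := flipsP hM.
by apply: (allP (crossings_lt w5)); rewrite E !mem_cat ha orbT.
Qed.
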